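(* Let $S$ be the set of positive integers $n$ such that $n!$ can be written as a sum of three squares of integers, and let $\bar{S}$ be the set of positive integers $n$ such that $n!$ cannot be written as a sum of three squares of integers. Then the set of gap sizes occurring in $S$ is exactly $\{1,2,3,4\}$, and the set of gap sizes occurring in $\bar{S}$ is exactly $$\{1,2,3,\dots,23,25,26,28,30,31,33,34,35,37,38,42\}.$$
   Context: For a set $A$ of integers, a positive integer $g$ is a gap size occurring in $A$ if there exist $x,y\in A$ with $x<y$, no element of $A$ strictly between $x$ and $y$, and $y-x=g$. *)

(* Defs.v *)
From mathcomp Require Import all_boot all_order all_algebra.
From mathcomp Require Import classical_sets.

Set Implicit Arguments.
Unset Strict Implicit.
Unset Printing Implicit Defensive.

Import Order.TTheory GRing.Theory Num.Theory.

Local Open Scope ring_scope.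
Local Open Scope classical_set_scope.

Definition gap_sizes (A : set int) : set nat :=
  [set g : nat | (0 < g)%N /\
    exists x y : int,
      [/\ A x, A y, x < y, (forall z : int, A z -> ~ (x < z < y)) &
          y - x = g%:Z]].

Definition sum_of_three_squares (m : int) : Prop :=
  exists a b c : int, m = a ^+ 2 + b ^+ 2 + c ^+ 2.

Definition fact_sum3sq : set int :=
  [set n%:Z | n in [set n : nat |
    (0 < n)%N /\ sum_of_three_squares (n`!)%:Z]].

Definition fact_not_sum3sq : set int :=
  [set n%:Z | n in [set n : nat |
    (0 < n)%N /\ ~ sum_of_three_squares (n`!)%:Z]].

(* Main.v *)
(** Legendre's three-square theorem turns the question into one about the
    2-adic square class of [n!], which is 2-automatic.

    Three squares: write [n = s^2 m] with [m] squarefree, [m <> 7 mod 8].  Choose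
    a prime [q = 1 mod 4] whose quadratic characters modulo 8 and modulo the
    odd primes dividing [m] make [x^2 + t y^2 = m w^2] locally solvable, where
    [t] is [q] or [2 q].  A pigeonhole argument solves it, [t] is a sum of two
    squares, and Aubry's descent makes the resulting rational representation
    of [m] integral.  Only real characters are prescribed for [q], so
    instead of the full theorem of Dirichlet one needs only [L(1, chi) <> 0] for
    real [chi] (Monsky's Lambert series argument) and Mertens' estimates.

    Gaps: the parity of [v_2(n!)] and the odd part of [n!] modulo 8 at [2 n] and
    [2 n + 1] are determined by [n mod 4] and their values at [n].  So the
    pattern on [[64 n, 64 n + 128)] depends only on a state of [n] taking
    finitely many values, and it suffices to inspect the reachable ones. *)

Require Import Defs.
From mathcomp Require Import classical_sets.
From mathcomp Require Import all_boot all_order all_algebra.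
From mathcomp Require Import all_fingroup all_solvable.
From mathcomp Require Import boolp reals exp Rstruct.
From mathcomp Require Import zify ring lra.

Set Implicit Arguments.
Unset Strict Implicit.
Unset Printing Implicit Defensive.

Import Order.TTheory GRing.Theory Num.Theory.

Local Open Scope ring_scope.

(** * Quadratic reciprocity *)

(** The residue of [m] modulo 8 enters through reciprocity. With [t = q] and [q = 1 mod 4],
    solvability modulo an odd prime [p] dividing [m] asks that [-q] be a square, so [q] must have
    character [chi4 p] there; by reciprocity an odd [m] then has character [chi4 m] modulo [q],
    which is 1 when [m = 1 mod 4]. With [t = 2 q] this becomes [chi4 m * chi8 m], which is 1 for
    [m = 3 mod 8] but -1 for [m = 7 mod 8]. For even [m] the class of [q] modulo 8 can be adjusted
    instead.

    No limit is ever taken. Nonvanishing of [L(1, chi)] is expressed by a partial sum that exceeds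
    the bound for its own tail, and Monsky's argument is run at one explicit parameter, with every
    error term bounded by hand.

    Blocks of 64 suffice for the gaps because the largest gap is 42: the next element after one in a
    block lies in that block or the following one. *)

Definition legendre (p a : nat) : int :=
  let u := (a%:R : 'F_p) ^+ p./2 in
  if u == 0 then 0 else if u == 1 then 1 else -1.

Definition is_sign0 (s : int) : bool := s \in [:: 0; 1; -1].

Lemma legendre_sign0 p a : is_sign0 (legendre p a).
Proof. by rewrite /legendre; case: ifP => // _; case: ifP. Qed.

Lemma eq_Fp_nat p m n :
  prime p -> ((m%:R : 'F_p) == n%:R) = (m == n %[mod p])%N.
Proof. by move=> pp; rewrite -val_eqE /= !val_Fp_nat. Qed.

Lemma Fp_nat_eq0 p n : prime p -> ((n%:R : 'F_p) == 0) = (p %| n)%N.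
Proof. by move=> pp; rewrite -[0]/(0%:R) eq_Fp_nat // mod0n. Qed.

(** Since [1] and [-1] differ in ['F_p] for odd [p], identities between signs may be proved in
    ['F_p], where the symbol is a power. *)
Lemma Fp_sign0_inj p s s' : prime p -> odd p -> is_sign0 s -> is_sign0 s' ->
  s%:~R = s'%:~R :> 'F_p -> s = s'.
Proof.
move=> pp op hs hs' e; have p1 := prime_gt1 pp.
have n1 : (1 : 'F_p) != 0 by rewrite oner_eq0.
have n2 : (1 : 'F_p) != -1.
  rewrite -subr_eq0 opprK -[1 + 1]/(2%:R) Fp_nat_eq0 //.
  by rewrite gtnNdvd //; lia.
move: hs hs' e n1 n2; rewrite /is_sign0 !inE.
case/or3P => /eqP-> /or3P [] /eqP->; rewrite ?mulr0z ?mulrNz ?mulr1z //;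
  move=> /eqP; rewrite ?(eq_sym (-1)) ?(eq_sym 0) ?oppr_eq0 => -> //.
Qed.

(** Euler's criterion is the definition of the symbol, so multiplicativity is immediate and the link
    with squares is proved apart. The branch [-1] is correct because by Fermat a nonzero power
    squares to 1. *)
Lemma legendreE p a : prime p -> odd p ->
  (legendre p a)%:~R = (a%:R : 'F_p) ^+ p./2.
Proof.
move=> pp op; rewrite /legendre; set u := _ ^+ _.
have [->|un0] := eqVneq u 0; first by rewrite mulr0z.
have [->|un1] := eqVneq u 1; first by rewrite mulr1z.
have an0 : (a%:R : 'F_p) != 0.
  apply: contra un0 => /eqP a0; rewrite /u a0 expr0n.
  by have := prime_gt1 pp; case: (p) => [|[|[]]].
have : u ^+ 2 = 1.
  rewrite /u -exprM muln2.
  have -> : (p./2.*2 = p.-1)%N by rewrite -[in RHS](odd_double_half p) op.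
  apply: (mulfI an0); rewrite -exprS prednK ?prime_gt0 // mulr1.
  by rewrite -natrX; apply/eqP; rewrite eq_Fp_nat //; apply/eqP/fermat_little.
move/eqP; rewrite sqrf_eq1 (negPf un1) /= => /eqP->.
by rewrite mulrNz mulr1z.
Qed.

Lemma is_sign0M s s' : is_sign0 s -> is_sign0 s' -> is_sign0 (s * s').
Proof.
by rewrite /is_sign0 !inE => /or3P [] /eqP-> /or3P [] /eqP->.
Qed.

Lemma legendreM p a b : prime p -> odd p ->
  legendre p (a * b) = legendre p a * legendre p b.
Proof.
move=> pp op; apply: (Fp_sign0_inj pp op); rewrite ?is_sign0M ?legendre_sign0 //.
by rewrite rmorphM /= !legendreE // natrM exprMn.
Qed.

Lemma legendre_mod p a : prime p -> legendre p (a %% p) = legendre p a.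
Proof. by move=> pp; rewrite /legendre Fp_nat_mod. Qed.

Lemma legendre1 p : legendre p 1 = 1.
Proof. by rewrite /legendre expr1n oner_eq0 eqxx. Qed.

Lemma legendre_eq0 p a : prime p -> odd p -> (legendre p a == 0) = (p %| a)%N.
Proof.
move=> pp op; rewrite -Fp_nat_eq0 //.
have h0 : (0 < p./2)%N by have := prime_gt1 pp; lia.
have <- : ((a%:R : 'F_p) ^+ p./2 == 0) = (a%:R == 0 :> 'F_p).
  by rewrite expf_eq0 h0.
by rewrite /legendre; case: ifP => // _; case: ifP.
Qed.

(** Write [a = g ^ k] with [g] a generator of the unit group. The power being 1, [p - 1] divides
    [k * p./2], so [k] is even. *)
Lemma legendre_eq1_square p a : prime p -> odd p -> legendre p a = 1 ->
  exists x : nat, (x * x = a %[mod p])%N.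
Proof.
move=> pp op e; have := legendreE a pp op; rewrite e mulr1z => {}e.
have an0 : (a%:R : 'F_p) \is a GRing.unit.
  rewrite unitfE Fp_nat_eq0 // -legendre_eq0 //; apply/eqP => z.
  by have := legendreE a pp op; rewrite z mulr0z -e => /eqP; rewrite eq_sym oner_eq0.
pose u : {unit 'F_p} := Sub (a%:R : 'F_p) an0.
have /cyclicP [g gE] := field_unit_group_cyclic [set: {unit 'F_p}]%G.
have : u \in <[g]>%g by rewrite -gE inE.
case/cycleP => k uk.
have og : #[g]%g = p.-1.
  rewrite orderE -gE card_finField_unit card_Fp //.
have : (#[g]%g %| k * p./2)%N.
  rewrite order_dvdn expgM -uk; apply/eqP/val_inj; rewrite FinRing.val_unitX /= -e //.
have h0 : (0 < p./2)%N by have := prime_gt1 pp; lia.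
have -> : #[g]%g = (2 * p./2)%N by rewrite og; lia.
rewrite dvdn_pmul2r // => /dvdnP [j kj].
exists (val (val (g ^+ j)%g)).
apply/eqP; rewrite -eq_Fp_nat //; apply/eqP.
have -> : (a%:R : 'F_p) = val u by [].
rewrite uk kj expgM natrM !natr_Zp -expr2.
by rewrite !FinRing.val_unitX -exprM.
Qed.

(** The polynomial ['X^(p./2) - 1] has at most [(p - 1) / 2] roots, too few for all [p - 1]
    units. *)
Lemma exists_legendreN1 p : prime p -> odd p ->
  exists a : nat, legendre p a = -1.
Proof.
move=> pp op.
have [/existsP [x xP]|/existsPn none] := boolP [exists x : 'F_p, legendre p x == -1].
  by exists (val x); apply/eqP.
have h0 : (0 < p./2)%N by have := prime_gt1 pp; lia.
have := @max_poly_roots 'F_p ('X^(p./2) - 1) (enum [pred x : 'F_p | x != 0]).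
rewrite -size_poly_eq0 size_XnsubC // => /(_ isT).
have -> : all (root ('X^(p./2) - 1)) (enum [pred x : 'F_p | x != 0]).
  apply/allP => x; rewrite mem_enum inE => xn.
  have l0 : legendre p x != 0 by rewrite legendre_eq0 // -Fp_nat_eq0 // natr_Zp.
  rewrite rootE !hornerE; have := none x; have := legendreE x pp op.
  rewrite natr_Zp => <-; move: l0; have := legendre_sign0 p x.
  rewrite /is_sign0 !inE.
  by case/or3P => /eqP-> //; rewrite mulr1z subrr.
rewrite enum_uniq -cardE => /(_ isT isT).
have -> : #|[pred x : 'F_p | x != 0]| = p.-1 by rewrite cardC1 card_Fp.
by lia.
Qed.

Lemma sum_bool_leq_mul (d n k : nat) : (0 < d)%N -> (n %/ d <= k)%N ->
  (\sum_(y < k) (d * y.+1 <= n) = n %/ d)%N.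
Proof.
move=> d0; elim: k => [|k IH] le.
  by rewrite big_ord0; apply/esym/eqP; rewrite -leqn0.
rewrite big_ord_recr /=; have [lek|gtk] := leqP (n %/ d) k.
  by rewrite IH // mulnC -leq_divRL // leqNgt ltnS lek addn0.
have ek : (n %/ d = k.+1)%N by apply/eqP; rewrite eqn_leq le gtk.
have -> : (d * k.+1 <= n)%N by rewrite mulnC -leq_divRL // ek.
rewrite (eq_bigr (fun=> 1%N)) ?sum1_card ?card_ord ?ek ?addn1 // => y _.
suff -> : (d * y.+1 <= n)%N by [].
by rewrite mulnC -leq_divRL // ek ltnS ltnW.
Qed.

(** The index [x] stands for the multiplier [x + 1], which runs from 1 to [(p - 1) / 2]. The flag
    says that the residue of least absolute value is negative; [gauss_abs] is that absolute
    value. *)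
Definition gauss_flip (p a x : nat) : bool := (p./2 < (a * x.+1) %% p)%N.

Definition gauss_abs (p a x : nat) : nat :=
  if gauss_flip p a x then (p - (a * x.+1) %% p)%N else ((a * x.+1) %% p)%N.

Lemma gauss_abs_bounds p a x : prime p -> odd p -> ~~ (p %| a)%N ->
  (x < p./2)%N -> (0 < gauss_abs p a x <= p./2)%N.
Proof.
move=> pp op na lx; rewrite /gauss_abs /gauss_flip.
have : ((a * x.+1) %% p != 0)%N.
  rewrite -/(dvdn _ _) Euclid_dvdM // (negPf na) /=.
  by rewrite gtnNdvd //; lia.
have := ltn_pmod (a * x.+1) (prime_gt0 pp); case: ifP; lia.
Qed.

Lemma gauss_abs_cong p a x : prime p ->
  (a%:R * x.+1%:R : 'F_p) = (-1) ^+ gauss_flip p a x * (gauss_abs p a x)%:R.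
Proof.
move=> pp; rewrite -natrM -(Fp_nat_mod pp (a * x.+1)) /gauss_abs.
case: gauss_flip; rewrite ?expr0 ?mul1r // expr1 mulN1r.
rewrite natrB ?pchar_Fp_0 ?sub0r ?opprK //; last by rewrite ltnW ?ltn_pmod ?prime_gt0.
Qed.

(** Equal absolute values force [x + 1] and [y + 1] to agree up to sign modulo [p], and their sum is
    less than [p], which rules out the opposite sign. *)
Lemma gauss_abs_bij p a : prime p -> odd p -> ~~ (p %| a)%N ->
  exists2 s : 'I_(p./2) -> 'I_(p./2), injective s &
    forall x : 'I_(p./2), gauss_abs p a x = (s x).+1.
Proof.
move=> pp op na.
have b (x : 'I_(p./2)) := gauss_abs_bounds pp op na (ltn_ord x).
have lt (x : 'I_(p./2)) : ((gauss_abs p a x).-1 < p./2)%N by have := b x; lia.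
exists (fun x => Ordinal (lt x)); last by move=> x /=; have := b x; lia.
move=> x y /(congr1 val) /= e.
have {}e : gauss_abs p a x = gauss_abs p a y by have := b x; have := b y; lia.
have := gauss_abs_cong a x pp; have := gauss_abs_cong a y pp; rewrite -e.
set g := (gauss_abs p a x)%:R; set A := a%:R => ey ex.
have An0 : A != 0 by rewrite Fp_nat_eq0.
have lxy : (x.+1 + y.+1 < p)%N by have := ltn_ord x; have := ltn_ord y; lia.
have : (x.+1%:R : 'F_p) = y.+1%:R \/ (x.+1 + y.+1)%:R = 0 :> 'F_p.
  move: ex ey; case: gauss_flip; case: gauss_flip; rewrite ?expr0 ?expr1 => ex ey.
  - by left; apply: (mulfI An0); rewrite ex ey.
  - by right; apply: (mulfI An0); rewrite natrD mulrDr ex ey; ring.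
  - by right; apply: (mulfI An0); rewrite natrD mulrDr ex ey; ring.
  - by left; apply: (mulfI An0); rewrite ex ey.
case=> /eqP; rewrite ?eq_Fp_nat ?Fp_nat_eq0 //.
- rewrite !modn_small; try lia; move=> /eqP exy; apply: val_inj => /=; lia.
- by rewrite gtnNdvd //; lia.
Qed.

(** Multiply the congruences for all multipliers: both sides contain the same factorial [P], since
    the absolute values permute its factors, and [P] cancels. *)
Lemma gauss_lemma p a : prime p -> odd p -> ~~ (p %| a)%N ->
  legendre p a = (-1) ^+ (\sum_(x < p./2) gauss_flip p a x)%N.
Proof.
move=> pp op na; apply: (Fp_sign0_inj pp op); rewrite ?legendre_sign0 //.
  by rewrite /is_sign0 -signr_odd; case: odd.
rewrite legendreE //; have [s sinj sE] := gauss_abs_bij pp op na.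
pose P : 'F_p := \prod_(x < p./2) x.+1%:R.
have Pn0 : P != 0.
  apply/prodf_neq0 => x _; rewrite Fp_nat_eq0 // gtnNdvd //.
  by have := ltn_ord x; lia.
apply: (mulIf Pn0).
have -> : a%:R ^+ p./2 * P = \prod_(x < p./2) (a%:R * x.+1%:R).
  by rewrite big_split /= prodr_const card_ord.
rewrite (eq_bigr _ (fun (x : 'I_(p./2)) _ => gauss_abs_cong a x pp)) big_split /=.
congr (_ * _).
  by rewrite rmorphXn /= prodrXr mulrNz.
rewrite [P](reindex_inj sinj) /=; apply: eq_bigr => x _; by rewrite sE.
Qed.

Lemma odd_sum (I : finType) (F : I -> nat) :
  odd (\sum_i F i) = \big[addb/false]_i odd (F i).
Proof. exact: (big_morph odd oddD). Qed.

(** Compare parities in the division of [a * (x + 1)] by [p]. As [a] and [p] are odd, the sums of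
    the multipliers and of the absolute residues cancel, and the flips have the parity of the
    quotients. *)
Lemma eisenstein_lemma p a : prime p -> odd p -> odd a -> ~~ (p %| a)%N ->
  legendre p a = (-1) ^+ (\sum_(x < p./2) (a * x.+1) %/ p)%N.
Proof.
move=> pp op oa na; rewrite gauss_lemma // -[LHS]signr_odd -[RHS]signr_odd.
congr (_ ^+ (nat_of_bool _)); have [s sinj sE] := gauss_abs_bij pp op na.
have e1 : odd (\sum_(x < p./2) x.+1) =
    odd (\sum_(x < p./2) gauss_abs p a x).
  rewrite (reindex_inj sinj); congr (odd _); apply: eq_bigr => x _; by rewrite sE.
have e2 : odd (\sum_(x < p./2) a * x.+1) = odd (\sum_(x < p./2) x.+1).
  by rewrite -big_distrr /= oddM oa.
have e3 : odd (\sum_(x < p./2) a * x.+1) =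
  odd (\sum_(x < p./2) (a * x.+1) %/ p) (+) (odd (\sum_(x < p./2) gauss_abs p a x)
   (+) odd (\sum_(x < p./2) gauss_flip p a x)).
  rewrite !odd_sum -!big_split /=; apply: eq_bigr => x _.
  rewrite {1}(divn_eq (a * x.+1) p) oddD oddM op andbT; congr (_ (+) _).
  rewrite /gauss_abs; case: gauss_flip; rewrite ?addbF // addbT.
  by rewrite oddB ?op //= ?negbK // ltnW // ltn_pmod // prime_gt0.
by move: e3; rewrite e2 e1; case: odd; case: odd; case: odd.
Qed.

Lemma half_mul_bound p q x :
  odd q -> (x < p./2)%N -> (q * x.+1 * 2 < (q./2).+1 * p * 2)%N.
Proof.
move=> oq lx; have -> : ((q./2).+1 * p * 2 = q.+1 * p)%N.
  by rewrite mulnAC; congr (_ * _)%N; lia.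
rewrite -mulnA; apply: (@leq_trans (q * p).+1); last by rewrite mulSn -add1n leq_add2r; lia.
by rewrite ltnS leq_mul2l; lia.
Qed.

Lemma quadratic_reciprocity p q : prime p -> prime q -> odd p -> odd q ->
  p != q -> legendre p q * legendre q p = (-1) ^+ (p./2 * q./2)%N.
Proof.
move=> pp pq op oq npq.
have npdq : ~~ (p %| q)%N by rewrite dvdn_prime2.
have nqdp : ~~ (q %| p)%N by rewrite dvdn_prime2 // eq_sym.
rewrite !eisenstein_lemma // -exprD; congr (_ ^+ _).
have p0 := prime_gt0 pp; have q0 := prime_gt0 pq.
rewrite (eq_bigr (fun x : 'I_(p./2) =>
  \sum_(y < q./2) ((p * y.+1 <= q * x.+1)%N : nat))%N); last first.
  move=> x _; rewrite sum_bool_leq_mul //.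
  by rewrite -ltnS ltn_divLR // -ltn_double -!muln2; apply: half_mul_bound.
rewrite [X in (_ + X)%N](eq_bigr (fun y : 'I_(q./2) =>
  \sum_(x < p./2) ((q * x.+1 <= p * y.+1)%N : nat))%N); last first.
  move=> y _; rewrite sum_bool_leq_mul //.
  by rewrite -ltnS ltn_divLR // -ltn_double -!muln2; apply: half_mul_bound.
rewrite [X in (_ + X)%N]exchange_big /= -big_split /=.
rewrite (eq_bigr (fun=> q./2)) ?sum_nat_const ?card_ord // => x _.
rewrite -big_split /= (eq_bigr (fun=> 1%N)) ?sum1_card ?card_ord // => y _.
(* The two exponents count the lattice points of a rectangle on either side of its diagonal; no
   point lies on the diagonal. *)
have : (p * y.+1 != q * x.+1)%N.
  apply/negP => /eqP e; have : (p %| q * x.+1)%N by rewrite -e dvdn_mulr.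
  rewrite Euclid_dvdM // (negPf npdq) /= gtnNdvd //.
  by have := ltn_ord x; lia.
by case: ltngtP.
Qed.

(** The multiples [2 * (x + 1)] stay below [p], so the unflipped ones are those at most [p./2], and
    there are [p./2 %/ 2] of them. *)
Lemma legendre_two p : prime p -> odd p ->
  legendre p 2 = if (p %% 8 \in [:: 1; 7])%N then 1 else -1.
Proof.
move=> pp op; have p1 := prime_gt1 pp.
have nd : ~~ (p %| 2)%N by rewrite gtnNdvd //; lia.
rewrite gauss_lemma // -signr_odd.
have e : (\sum_(x < p./2) gauss_flip p 2 x + p./2 %/ 2 = p./2)%N.
  rewrite -[X in (_ + X)%N](@sum_bool_leq_mul 2 p./2 p./2) //; last by lia.
  rewrite -big_split /= (eq_bigr (fun=> 1%N)) ?sum1_card ?card_ord // => x _.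
  rewrite /gauss_flip modn_small; last by have := ltn_ord x; lia.
  by rewrite ltnNge; case: leqP.
set s := (\sum_(x < _) _)%N in e *.
have -> : odd s = ~~ (p %% 8 \in [:: 1; 7])%N by rewrite !inE; lia.
by case: (_ \in _).
Qed.

Lemma legendre_predp p : prime p -> odd p ->
  legendre p p.-1 = if (p %% 4 == 1)%N then 1 else -1.
Proof.
move=> pp op; apply: (Fp_sign0_inj pp op); rewrite ?legendre_sign0 //.
  by case: ifP.
rewrite legendreE //.
have -> : (p.-1%:R : 'F_p) = -1.
  apply/eqP; rewrite -subr_eq0 opprK -mulrSr prednK ?prime_gt0 //.
  by rewrite Fp_nat_eq0.
rewrite -signr_odd; have -> : odd p./2 = (p %% 4 != 1)%N by lia.
by case: (_ == _); rewrite ?mulrNz ?mulr1z.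
Qed.

(** * Real characters *)

(** That the character is not principal is encoded by [char_sum0]; this is what keeps its partial
    sums bounded. *)
Record real_character (R : realType) (M : nat) (chi : nat -> R) : Prop :=
  RealCharacter {
    char_modulus_gt0 : (0 < M)%N;
    char_periodic : forall n, chi (n + M)%N = chi n;
    char_mul : forall m n, chi (m * n)%N = chi m * chi n;
    char_one : chi 1 = 1;
    char_values : forall n, [\/ chi n = 0, chi n = 1 | chi n = -1];
    char_sum0 : \sum_(0 <= i < M) chi i = 0
  }.

Lemma char_norm_le1 (R : realType) M (chi : nat -> R) n :
  real_character M chi -> `|chi n| <= 1.
Proof.
move=> hc; have [->|->|->] := char_values hc n; rewrite ?normrN ?normr0 ?normr1 //.
Qed.

Lemma char_sum_le (R : realType) M (chi : nat -> R) n :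
  real_character M chi -> `|\sum_(0 <= i < n) chi i| <= M%:R.
Proof.
move=> hc; have [k] := ubnP n; elim: k n => // k IH n ltnk.
have [ltnM|leMn] := ltnP n M.
  apply: (le_trans (ler_norm_sum _ _ _)).
  apply: (@le_trans _ _ (\sum_(0 <= i < n) 1)).
    by apply: ler_sum => i _; apply: char_norm_le1 hc.
  by rewrite big_const_nat iter_addr_0 subn0 ler_nat ltnW.
rewrite (@big_cat_nat _ _ _ M) //= (char_sum0 hc) add0r.
rewrite -{1}[M]add0n big_addn.
rewrite (eq_bigr chi); last by move=> i _; exact: char_periodic.
by apply: IH; have := char_modulus_gt0 hc; lia.
Qed.

Lemma char_interval_sum_le (R : realType) M (chi : nat -> R) a b :
  real_character M chi -> (a <= b)%N ->
  `|\sum_(a <= i < b) chi i| <= 2 * M%:R.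
Proof.
move=> hc leab; have := char_sum_le b hc; have := char_sum_le a hc.
rewrite (@big_cat_nat _ _ _ a 0 b) //=.
set s := \sum_(0 <= i < a) _; set s' := \sum_(a <= i < b) _ => h1 h2.
have -> : s' = s + s' - s by ring.
by apply: (le_trans (ler_normB _ _)); lra.
Qed.

Lemma abel_summation_le (R : realType) (u f : nat -> R) (B : R) (a b : nat) :
  (forall c, (a <= c)%N -> `|\sum_(a <= i < c) u i| <= B) ->
  (forall i, (a <= i)%N -> 0 <= f i) ->
  (forall i, (a <= i)%N -> f i.+1 <= f i) -> (a <= b)%N ->
  `|\sum_(a <= i < b) u i * f i| <= B * f a.
Proof.
move=> hU f0 fdec leab.
(* With the boundary term subtracted, each induction step adds the current partial sum of [u] times
   a drop of [f], so the bounds telescope. *)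
suff {leab} key n : `|\sum_(a <= i < a + n) u i * f i
    - (\sum_(a <= i < a + n) u i) * f (a + n)%N| <= B * (f a - f (a + n)%N).
  have := key (b - a)%N; rewrite subnKC //.
  have := hU b leab; have := f0 b leab.
  set S := \sum_(a <= i < b) _ * _; set U := \sum_(a <= i < b) _ => fb hb h.
  have -> : S = (S - U * f b) + U * f b by ring.
  apply: (le_trans (ler_normD _ _)); rewrite normrM (ger0_norm fb).
  have : `|U| * f b <= B * f b by apply: ler_wpM2r.
  by lra.
elim: n => [|n IH]; first by rewrite addn0 !big_geq // mul0r !subrr normr0 mulr0.
have len : (a <= a + n)%N by apply: leq_addr.
rewrite addnS !big_nat_recr //=.
have := hU (a + n).+1 (leqW len); rewrite big_nat_recr //=.
set S := \sum_(a <= i < _) _ * _ in IH *; set U := \sum_(a <= i < _) _ in IH *.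
have := fdec _ len; set x := f (a + n)%N in IH *; set y := f (a + n).+1.
set v := u _ => lexy hUv.
have -> : S + v * x - (U + v) * y = (S - U * x) + (U + v) * (x - y) by ring.
apply: (le_trans (ler_normD _ _)); rewrite normrM (ger0_norm (_ : 0 <= x - y)).
  have : `|U + v| * (x - y) <= B * (x - y) by apply: ler_wpM2r => //; lra.
  by lra.
by lra.
Qed.

Definition harmonic_sum (R : realType) (chi : nat -> R) (N : nat) : R :=
  \sum_(1 <= n < N.+1) chi n * n%:R^-1.

(** Abel summation with weights [1 / n]. This explicit Cauchy estimate replaces the convergence of
    the series for [L(1, chi)]. *)
Lemma harmonic_tail_le (R : realType) M (chi : nat -> R) N K :
  real_character M chi -> (N <= K)%N ->
  `|harmonic_sum chi K - harmonic_sum chi N| <= 2 * M%:R * N.+1%:R^-1.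
Proof.
move=> hc leNK; rewrite /harmonic_sum (@big_cat_nat _ _ _ N.+1 1 K.+1) //=.
rewrite [X in `|X|]addrC addKr.
apply: (@abel_summation_le _ _ (fun n => n%:R^-1)) => //.
- by move=> c; apply: char_interval_sum_le.
- by move=> i _; rewrite invr_ge0.
- by move=> i lei; rewrite lef_pV2 ?posrE ?ltr0n ?ler_nat //; lia.
Qed.

Lemma harmonic_sum_le (R : realType) M (chi : nat -> R) N :
  real_character M chi -> `|harmonic_sum chi N| <= 2 * M%:R.
Proof.
move=> hc; have := harmonic_tail_le hc (leq0n N).
by rewrite {2}/harmonic_sum big_geq // subr0 invr1 mulr1.
Qed.

Lemma sum_multiples (V : nmodType) (d N : nat) (F : nat -> V) : (0 < d)%N ->
  \sum_(1 <= n < N.+1 | (d %| n)%N) F n =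
  \sum_(1 <= j < (N %/ d).+1) F (d * j)%N.
Proof.
move=> d0; elim: N => [|N IH]; first by rewrite div0n !big_geq.
rewrite big_mkcond big_nat_recr //= -big_mkcond IH divnS //.
case: ifP => [dv|_]; last by rewrite addr0.
rewrite add1n [RHS]big_nat_recr //=; congr (_ + F _).
rewrite -[in LHS](divnK dv) divnS // dv add1n; ring.
Qed.

Lemma perm_divisors_coprime a b : (0 < a)%N -> (0 < b)%N -> coprime a b ->
  perm_eq (divisors (a * b)) [seq (x * y)%N | x <- divisors a, y <- divisors b].
Proof.
move=> a0 b0 cab; have ab0 : (0 < a * b)%N by rewrite muln_gt0 a0.
apply: uniq_perm; first exact: divisors_uniq.
- apply: allpairs_uniq; rewrite ?divisors_uniq //.
  move=> [x y] [x' y'] /allpairsP [[u v] /= [hu hv [-> ->]]].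
  move=> /allpairsP [[u' v'] /= [hu' hv' [-> ->]]] /= e.
  move: hu hv hu' hv'; rewrite -!dvdn_divisors // => hu hv hu' hv'.
  (* A product of divisors is separated again by a gcd with [a], since [z] is coprime to [a]. *)
  have gE w z : (w %| a)%N -> (z %| b)%N -> gcdn (w * z) a = w.
    move=> wa zb; have cz : coprime z a.
      by rewrite coprime_sym; apply: coprime_dvdr zb cab.
    by rewrite gcdnC Gauss_gcdl 1?coprime_sym //; apply/gcdn_idPr.
  have eu : u = u' by rewrite -(gE u v) // e gE.
  have u'0 : (0 < u')%N by apply: dvdn_gt0 hu'.
  by move/eqP: e; rewrite eu eqn_pmul2l // => /eqP->.
- move=> d; rewrite -dvdn_divisors //; apply/idP/allpairsP.
  + move=> dab; exists (gcdn d a, gcdn d b) => /=.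
    rewrite -!dvdn_divisors // !dvdn_gcdr; split=> //.
    apply/eqP; rewrite eqn_dvd; apply/andP; split.
      by rewrite muln_gcdl !muln_gcdr !dvdn_gcd (dvdn_mull d (dvdnn _)) dvdn_mulr //
        dvdn_mull //= mulnC.
    by rewrite Gauss_dvd ?dvdn_gcdl //; apply: coprime_dvdl (dvdn_gcdr _ _) _;
       apply: coprime_dvdr (dvdn_gcdr _ _) _.
  + case=> [[u v]] /= []; rewrite -!dvdn_divisors // => ua vb ->.
    exact: dvdn_mul.
Qed.

Lemma perm_divisors_pfactor p e : prime p ->
  perm_eq (divisors (p ^ e)) [seq (p ^ j)%N | j <- iota 0 e.+1].
Proof.
move=> pp; have p1 := prime_gt1 pp; apply: uniq_perm; first exact: divisors_uniq.
- by rewrite map_inj_uniq ?iota_uniq //; apply: expnI.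
- move=> d; rewrite -dvdn_divisors ?expn_gt0 ?prime_gt0 //.
  apply/(dvdn_pfactor _ _ pp)/mapP => [[m le ->]|[j]].
    by exists m; rewrite // mem_iota /= add0n.
  by rewrite mem_iota /= add0n ltnS => le ->; exists j.
Qed.

(** These are the Dirichlet coefficients of [zeta(s) L(s, chi)], and also the power series
    coefficients of the Lambert series of [chi]. *)
Definition divisor_sum (R : realType) (chi : nat -> R) (m : nat) : R :=
  \sum_(d <- divisors m) chi d.

Lemma divisor_sum_coprime (R : realType) M (chi : nat -> R) a b :
  real_character M chi -> (0 < a)%N -> (0 < b)%N -> coprime a b ->
  divisor_sum chi (a * b) = divisor_sum chi a * divisor_sum chi b.
Proof.
move=> hc a0 b0 cab; rewrite /divisor_sum (perm_big _ (perm_divisors_coprime a0 b0 cab)).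
rewrite big_allpairs_dep big_distrl; apply: eq_bigr => x _.
by rewrite big_distrr; apply: eq_bigr => y _; exact: char_mul hc _ _.
Qed.

Lemma char_exp (R : realType) M (chi : nat -> R) n j :
  real_character M chi -> chi (n ^ j)%N = chi n ^+ j.
Proof.
move=> hc; elim: j => [|j IH]; first by rewrite (char_one hc).
by rewrite expnS (char_mul hc) IH exprS.
Qed.

(** The local factor [1 + chi p + ... + chi p ^+ e] is 1, [e + 1], or an alternating sum equal to 1
    for even [e] and 0 for odd [e]. *)
Lemma divisor_sum_pfactor (R : realType) M (chi : nat -> R) p e :
  real_character M chi -> prime p ->
  0 <= divisor_sum chi (p ^ e) /\ (~~ odd e -> 1 <= divisor_sum chi (p ^ e)).
Proof.
move=> hc pp; rewrite /divisor_sum (perm_big _ (perm_divisors_pfactor e pp)).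
rewrite big_map -[iota _ _]/(index_iota 0 e.+1).
under eq_bigr do rewrite (char_exp _ _ hc).
have [->|->|->] := char_values hc p.
- rewrite big_nat_recl //= expr0 big1 ?addr0 ?ler01 //.
  by move=> i _; rewrite expr0n.
- under eq_bigr do rewrite expr1n.
  by rewrite big_const_nat iter_addr_0 ler0n ler1n.
- have -> : \sum_(0 <= i < e.+1) (-1 : R) ^+ i = (~~ odd e)%:R.
    elim: e => [|e IH]; first by rewrite big_nat1.
    by rewrite big_nat_recr //= IH -signr_odd /=; case: odd => /=; lra.
  by case: odd.
Qed.

Lemma pfactor_cofactor (n : nat) : (1 < n)%N ->
  exists p e m, [/\ prime p, (0 < e)%N, (0 < m < n)%N, coprime (p ^ e) m &
                    n = (p ^ e * m)%N].
Proof.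
move=> n1; have pp := pdiv_prime n1; set p := pdiv n in pp.
have n0 : (0 < n)%N by lia.
have e0 : (0 < logn p n)%N by rewrite logn_gt0 mem_primes pp n0 pdiv_dvd.
exists p, (logn p n), (n`_p^')%N; have nE := partnC p n0.
rewrite p_part in nE; have m0 : (0 < n`_p^')%N by apply: part_gt0.
have cop : coprime (p ^ logn p n) (n`_p^')%N.
  by rewrite coprime_pexpl // prime_coprime // -p'natE // part_pnat.
split=> //; rewrite m0 /= -{2}nE -{1}[(n`_p^')%N]mul1n ltn_pmul2r //.
by rewrite -(expn0 p) ltn_exp2l // prime_gt1.
Qed.

Lemma divisor_sum_ge0 (R : realType) M (chi : nat -> R) n :
  real_character M chi -> 0 <= divisor_sum chi n.
Proof.
move=> hc; have [k] := ubnP n; elim: k n => // k IH n ltn.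
have [n1|] := ltnP 1 n.
  have [p [e [m [pp e0 /andP [m0 mn] cop ->]]]] := pfactor_cofactor n1.
  have pe0 : (0 < p ^ e)%N by rewrite expn_gt0 prime_gt0.
  rewrite (divisor_sum_coprime hc pe0 m0 cop); apply: mulr_ge0.
    by have [] := divisor_sum_pfactor e hc pp.
  by apply: IH; lia.
by case: n ltn => [|[|]] // _ _; rewrite /divisor_sum big_seq1 (char_one hc).
Qed.

(** A square has even exponents, so every local factor is at least 1. These coefficients make the
    Lambert series large near 1. *)
Lemma divisor_sum_square_ge1 (R : realType) M (chi : nat -> R) n :
  real_character M chi -> (0 < n)%N -> 1 <= divisor_sum chi (n * n).
Proof.
move=> hc; have [k] := ubnP n; elim: k n => // k IH n ltn n0.
have [n1|n1] := ltnP 1 n; last first.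
  have -> : n = 1%N by lia.
  by rewrite /divisor_sum big_seq1 (char_one hc).
have [p [e [m [pp e0 /andP [m0 mn] cop ->]]]] := pfactor_cofactor n1.
have pe0 : (0 < p ^ (e + e))%N by rewrite expn_gt0 prime_gt0.
have mm0 : (0 < m * m)%N by rewrite muln_gt0 m0.
have cop2 : coprime (p ^ (e + e)) (m * m).
  by rewrite expnD coprimeMl !coprimeMr !cop.
rewrite mulnACA -expnD (divisor_sum_coprime hc pe0 mm0 cop2).
have [_ h1] := divisor_sum_pfactor (e + e) hc pp.
rewrite -[1]mulr1; apply: ler_pM; rewrite ?ler01 //.
  by apply: h1; rewrite oddD addbb.
by apply: IH; lia.
Qed.

(** * Non-vanishing at 1 *)

Definition geom (R : realType) (t : R) (n : nat) : R := \sum_(i < n) t ^+ i.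

Lemma geomSl (R : realType) (t : R) n : geom t n.+1 = 1 + t * geom t n.
Proof.
rewrite /geom big_ord_recl expr0 big_distrr /=; congr (_ + _).
by apply: eq_bigr => i _; rewrite exprS.
Qed.

Lemma geomSr (R : realType) (t : R) n : geom t n.+1 = geom t n + t ^+ n.
Proof. by rewrite /geom big_ord_recr. Qed.

Lemma geomE (R : realType) (t : R) n : geom t n * (1 - t) = 1 - t ^+ n.
Proof.
elim: n => [|n IH]; first by rewrite /geom big_ord0 mul0r subrr.
by rewrite geomSr mulrDl IH exprS; ring.
Qed.

Lemma geom_ge1 (R : realType) (t : R) n : 0 <= t -> 1 <= geom t n.+1.
Proof.
move=> t0; rewrite geomSl lerDl mulr_ge0 //.
by apply: sumr_ge0 => i _; apply: exprn_ge0.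
Qed.

(** With [t = s ^+ 2], the terms [t^i] and [t^(n-i)] have geometric mean [s^n]; the induction
    removes both end terms at once. Working with [s] makes half-integral powers of [t] available. *)
Lemma geom_amgm (R : realType) (s : R) n : 0 <= s ->
  n.+1%:R * s ^+ n <= geom (s ^+ 2) n.+1.
Proof.
move=> s0; have [k] := ubnP n; elim: k n => // k IH [|[|n]] ltnk.
- by rewrite /geom big_ord1 !expr0 mulr1.
- rewrite geomSr /geom big_ord1 expr0 !expr1.
  by have := sqr_ge0 (s - 1); nra.
- rewrite geomSl geomSr mulrDr -exprS.
  have := IH n ltac:(lia); set G := geom _ _ => h.
  have h1 : s ^+ 2 * (n.+1%:R * s ^+ n) <= s ^+ 2 * G by rewrite ler_wpM2l ?sqr_ge0.
  have h2 := sqr_ge0 (s ^+ n.+2 - 1).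
  have e1 : s ^+ 2 * (n.+1%:R * s ^+ n) = n.+1%:R * s ^+ n.+2 by rewrite mulrCA -exprD.
  have e2 : (s ^+ 2) ^+ n.+2 = s ^+ n.+2 ^+ 2 by rewrite exprAC.
  have e3 : n.+3%:R = n.+1%:R + 2 :> R by rewrite -natrD addn2.
  rewrite e1 in h1; rewrite e2 e3.
  by move: h1 h2; set x := s ^+ n.+2; set N := n.+1%:R; set y := _ * G => h1 h2; nra.
Qed.

(** By [geomE] this is [(1 - t) t^n / (1 - t^n)], the Lambert term scaled so as to tend to [1 / n]
    when [t] tends to 1. *)
Definition lambert_term (R : realType) (t : R) (n : nat) : R := t ^+ n / geom t n.

Definition lambert_defect (R : realType) (t : R) (n : nat) : R :=
  n%:R^-1 - lambert_term t n.

Lemma lambert_defect_ge0 (R : realType) (s : R) n : 0 < s -> s < 1 ->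
  0 <= lambert_defect (s ^+ 2) n.+1.
Proof.
move=> s0 s1; rewrite /lambert_defect /lambert_term subr_ge0.
have t0 : 0 <= s ^+ 2 by apply: sqr_ge0.
have G1 := geom_ge1 n t0; have G0 : 0 < geom (s ^+ 2) n.+1 by lra.
rewrite ler_pdivrMr // mulrC ler_pdivlMr ?ltr0n //.
apply: le_trans (geom_amgm n (ltW s0)).
rewrite mulrC ler_wpM2l ?ler0n //.
rewrite -exprM; apply: ler_wiXn2l; try lra; lia.
Qed.

(** Because [geom t n.+2 = 1 + t * geom t n.+1], consecutive Lambert terms differ by
    [t ^+ n.+1 / (G * G')]. Two uses of the mean inequality bound this by the difference of the
    reciprocals. *)
Lemma lambert_defect_decr (R : realType) (s : R) n : 0 < s -> s < 1 ->
  lambert_defect (s ^+ 2) n.+2 <= lambert_defect (s ^+ 2) n.+1.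
Proof.
move=> s0 s1; rewrite /lambert_defect /lambert_term.
have t0 : 0 <= s ^+ 2 by apply: sqr_ge0.
have G1 := geom_ge1 n t0; have G0 : 0 < geom (s ^+ 2) n.+1 by lra.
have G1' := geom_ge1 n.+1 t0; have G0' : 0 < geom (s ^+ 2) n.+2 by lra.
have A := geom_amgm n (ltW s0); have A' := geom_amgm n.+1 (ltW s0).
have eG := geomSl (s ^+ 2) n.+1.
set G := geom _ n.+1 in G1 G0 A eG *; set G' := geom _ n.+2 in G1' G0' A' eG *.
set t := s ^+ 2 in t0 eG *.
have N0 : 0 < n.+1%:R :> R by rewrite ltr0n.
have N0' : 0 < n.+2%:R :> R by rewrite ltr0n.
have key : n.+1%:R * n.+2%:R * t ^+ n.+1 <= G * G'.
  have h : (n.+1%:R * s ^+ n) * (n.+2%:R * s ^+ n.+1) <= G * G'.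
    by apply: ler_pM => //; rewrite mulr_ge0 ?exprn_ge0 ?ler0n ?(ltW s0).
  apply: le_trans h.
  have -> : n.+1%:R * s ^+ n * (n.+2%:R * s ^+ n.+1) =
      n.+1%:R * n.+2%:R * s ^+ (n + n.+1) by rewrite exprD; ring.
  rewrite ler_wpM2l ?mulr_ge0 ?ler0n // /t -exprM.
  by apply: ler_wiXn2l; rewrite ?(ltW s0) ?(ltW s1) // mul2n -addnn addSn ltnW.
have e1 : n.+1%:R^-1 - n.+2%:R^-1 = (n.+1%:R * n.+2%:R)^-1 :> R.
  have -> : n.+2%:R = n.+1%:R + 1 :> R by rewrite -[n.+2]addn1 natrD.
  field; apply/andP; split; lra.
have e2 : t ^+ n.+1 / G - t ^+ n.+2 / G' = t ^+ n.+1 / (G * G').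
  rewrite (exprS t n.+1); have -> : t * t ^+ n.+1 / G' = t * G * (t ^+ n.+1) / (G * G').
    by field; apply/andP; split; lra.
  have -> : t ^+ n.+1 / G = G' * t ^+ n.+1 / (G * G').
    by field; apply/andP; split; lra.
  by rewrite -mulrBl -mulrBl eG addrK mul1r.
suff : t ^+ n.+1 / (G * G') <= (n.+1%:R * n.+2%:R)^-1.
  rewrite -e1 -e2; set a := t ^+ n.+1 / G; set b := t ^+ n.+2 / G'.
  by set c := n.+1%:R^-1; set d := n.+2%:R^-1; lra.
by rewrite ler_pdivrMr ?mulr_gt0 // mulrC ler_pdivlMr ?mulr_gt0 // mulrC.
Qed.

(** This is the remainder of the geometric series for [t^n / (1 - t^n)] after [J] terms, scaled by
    [1 - t]. *)
Lemma lambert_truncation (R : realType) (t : R) n J : 0 < t -> t < 1 ->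
  lambert_term t n.+1 - (1 - t) * \sum_(1 <= j < J.+1) t ^+ (n.+1 * j) =
  t ^+ (n.+1 * J.+1) / geom t n.+1.
Proof.
move=> t0 t1; have G1 := geom_ge1 n (ltW t0).
have G0 : 0 < geom t n.+1 by lra.
have gE := geomE t n.+1; rewrite /lambert_term; elim: J => [|J IH].
  by rewrite big_geq // mulr0 subr0 muln1.
rewrite big_nat_recr //= mulrDr opprD addrA IH.
have -> : t ^+ (n.+1 * J.+2) = t ^+ (n.+1 * J.+1) * t ^+ n.+1.
  by rewrite -exprD; congr (_ ^+ _); lia.
set x := t ^+ (n.+1 * J.+1).
have -> : t ^+ n.+1 = 1 - geom t n.+1 * (1 - t) by rewrite gE; ring.
by field; lra.
Qed.

Lemma sum_squares_le (R : realType) (F : nat -> R) Q K :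
  (forall m, 0 <= F m) -> (Q * Q <= K)%N ->
  \sum_(1 <= k < Q.+1) F (k * k)%N <= \sum_(1 <= m < K.+1) F m.
Proof.
move=> F0; elim: Q K => [|Q IH] K leK; first by rewrite big_geq // sumr_ge0.
rewrite big_nat_recr //=.
have eQ : (Q.+1 * Q.+1 = (Q * Q + Q + Q).+1)%N by rewrite mulSn mulnS; lia.
rewrite eQ in leK *.
rewrite (@big_cat_nat _ _ _ (Q * Q + Q + Q).+2 1 K.+1) //=.
rewrite -[leLHS]addr0 lerD ?sumr_ge0 // [leRHS]big_nat_recr //=.
by rewrite lerD //; apply: IH; rewrite -addnA leq_addr.
Qed.

Lemma bernoulli_upper (R : realType) (x : R) n : 0 <= x -> x <= 1 ->
  (1 - x) ^+ n * (1 + n%:R * x) <= 1.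
Proof.
move=> x0 x1; elim: n => [|n IH]; first by rewrite expr0 mul0r addr0 mulr1.
apply: le_trans IH; rewrite exprSr -mulrA ler_wpM2l ?exprn_ge0 //; first by lra.
rewrite -[n.+1]addn1 natrD; have : 0 <= n%:R :> R by [].
by set N := n%:R => N0; nra.
Qed.

Lemma bernoulli_lower (R : realType) (x : R) n : 0 <= x -> x <= 1 ->
  1 - n%:R * x <= (1 - x) ^+ n.
Proof.
move=> x0 x1; elim: n => [|n IH]; first by rewrite expr0 mul0r subr0.
rewrite exprSr; apply: (@le_trans _ _ ((1 - n%:R * x) * (1 - x))).
  rewrite -[n.+1]addn1 natrD; have : 0 <= n%:R :> R by [].
  by set N := n%:R => N0; nra.
by rewrite ler_wpM2r //; lra.
Qed.

(** Expanding each Lambert term as a geometric series and collecting exponents produces the divisor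
    sums. Replacing the scaled terms by [1 / n] gives the harmonic sum; the defects decrease from
    [1 - t], so Abel summation bounds their contribution. The last summand on the right is the
    truncation error. *)
Lemma lambert_sum_le (R : realType) M (chi : nat -> R) (s : R) K :
  real_character M chi -> 0 < s -> s < 1 -> (0 < K)%N ->
  (1 - s ^+ 2) * \sum_(1 <= m < K.+1) divisor_sum chi m * (s ^+ 2) ^+ m <=
  2 * M%:R * (1 - s ^+ 2) + `|harmonic_sum chi K| + K%:R * (s ^+ 2) ^+ K.
Proof.
move=> hc s0 s1 K0; set t := s ^+ 2.
have t0 : 0 < t by apply: exprn_gt0.
have t1 : t < 1 by rewrite /t; nra.
have swap : \sum_(1 <= m < K.+1) divisor_sum chi m * t ^+ m =
    \sum_(1 <= n < K.+1) chi n * \sum_(1 <= j < (K %/ n).+1) t ^+ (n * j).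
  transitivity (\sum_(1 <= m < K.+1) \sum_(1 <= n < K.+1 | (n %| m)%N) chi n * t ^+ m).
    apply: eq_big_nat => m /andP [m0 mK].
    rewrite /divisor_sum big_distrl -[RHS]big_filter /=; apply: perm_big.
    apply: uniq_perm; rewrite ?divisors_uniq ?filter_uniq ?iota_uniq // => d.
    rewrite mem_filter mem_index_iota -dvdn_divisors //.
    have [dm|//] := boolP (d %| m)%N; have := dvdn_leq m0 dm.
    by have := dvdn_gt0 m0 dm; lia.
  rewrite (exchange_big_dep_nat predT) //=; apply: eq_big_nat => n /andP [n0 nK].
  by rewrite -big_distrr -(sum_multiples K (fun m => t ^+ m)).
have Tsum : \sum_(1 <= n < K.+1) chi n * lambert_term t n =
  harmonic_sum chi K - \sum_(1 <= n < K.+1) chi n * lambert_defect t n.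
  rewrite /harmonic_sum -sumrB; apply: eq_bigr => n _.
  by rewrite /lambert_defect; ring.
have Dsum : `|\sum_(1 <= n < K.+1) chi n * lambert_defect t n| <= 2 * M%:R * (1 - t).
  have -> : 1 - t = lambert_defect t 1.
    by rewrite /lambert_defect /lambert_term /geom big_ord1 expr0 expr1 !divr1 invr1.
  apply: abel_summation_le => //.
  - by move=> c; apply: char_interval_sum_le.
  - by case=> // i _; apply: lambert_defect_ge0.
  - by case=> // i _; apply: lambert_defect_decr.
have diff : `|\sum_(1 <= n < K.+1) chi n * lambert_term t n -
   (1 - t) * \sum_(1 <= m < K.+1) divisor_sum chi m * t ^+ m| <= K%:R * t ^+ K.
  rewrite swap big_distrr -sumrB /=.
  apply: (le_trans (ler_norm_sum _ _ _)).
  apply: (@le_trans _ _ (\sum_(1 <= n < K.+1) t ^+ K)); last first.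
    by rewrite big_const_nat iter_addr_0 subn1 /= mulr_natl.
  apply: ler_sum_nat => -[//|n] /andP [_ nK].
  rewrite [X in _ - X]mulrCA -mulrBr lambert_truncation // normrM -[leRHS]mul1r.
  have G1 := geom_ge1 n (ltW t0).
  apply: ler_pM; rewrite ?normr_ge0 ?(char_norm_le1 _ hc) // ger0_norm; last first.
    by rewrite divr_ge0 ?exprn_ge0 ?(ltW t0) //; lra.
  rewrite ler_pdivrMr; last by lra.
  rewrite -[leLHS]mulr1; apply: ler_pM; rewrite ?exprn_ge0 ?ler01 ?(ltW t0) ?(ltW s0) //.
  (* The first omitted multiple of each [n] exceeds [K], so each truncation costs at most
     [t ^+ K]. *)
  apply: ler_wiXn2l; rewrite ?(ltW t0) ?(ltW t1) //.
  by rewrite mulnC ltnW // -ltn_divLR.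
move: Tsum Dsum diff; set A := \sum_(_ <= n < _) _ * lambert_term _ _.
set D := \sum_(_ <= n < _) _ * lambert_defect _ _; set B := (1 - t) * _.
set H := harmonic_sum _ _ => Tsum Dsum diff.
have := ler_norm H; have := ler_norm (- D); have := ler_norm (- (A - B)).
by rewrite !normrN; lra.
Qed.

(** Together with [harmonic_tail_le] the inequality keeps all later partial sums away from 0. If it
    failed at [K], the upper bound of [lambert_sum_le] would be at most [(4 M + 1) (1 - t)], while
    the square indices alone give [(1 - t) Q / 2]. *)
Lemma harmonic_sum_nonvanishing (R : realType) M (chi : nat -> R) :
  real_character M chi ->
  exists K, 2 * M%:R * K.+1%:R^-1 < `|harmonic_sum chi K|.
Proof.
move=> hc.
(* With [w = 1 - 1/T] and [t = w^4]: [T = 8 Q^2] keeps [t^(k k)] at least 1/2 for [k <= Q];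
   [K = T^2] gives [w^K <= 1/T], hence [K t^K <= 1/T^2]; and [Q = 8 M + 3] makes [Q / 2] exceed
   [4 M + 1]. *)
have [Q defQ] : {Q | Q = 8 * M + 3}%N by eexists.
have [T defT] : {T | T = 8 * (Q * Q)}%N by eexists.
have [K defK] : {K | K = T * T}%N by eexists.
have Q0 : (0 < Q)%N by rewrite defQ addn3.
have T1n : (1 < T)%N by rewrite defT (@leq_trans (8 * 1)) // leq_mul2l /= muln_gt0 Q0.
have T0n : (0 < T)%N by apply: ltnW.
have T0 : 0 < T%:R :> R by rewrite ltr0n.
have T1 : 1 < T%:R :> R by rewrite ltr1n.
exists K; rewrite ltNge; apply/negP => hK.
pose x : R := T%:R^-1; pose w := 1 - x.
have x0 : 0 < x by rewrite invr_gt0.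
have x1 : x < 1 by rewrite invf_lt1.
have xT : x * T%:R = 1 by rewrite mulVf // gt_eqF.
have w0 : 0 < w by rewrite /w; lra.
have w1 : w < 1 by rewrite /w; lra.
have s0 : 0 < w ^+ 2 by rewrite exprn_gt0.
have s1 : w ^+ 2 < 1 by nra.
have K0 : (0 < K)%N by rewrite defK muln_gt0 T0n.
have := lambert_sum_le hc s0 s1 K0.
have tE n : (w ^+ 2 ^+ 2) ^+ n = (w ^+ n) ^+ 4 by rewrite -!exprM; congr (_ ^+ _); lia.
set t := w ^+ 2 ^+ 2 in tE *.
have t0 : 0 < t by rewrite exprn_gt0.
have tx : x <= 1 - t.
  suff : t <= w by rewrite /w; lra.
  by rewrite /t; nra.
have KE : K%:R = T%:R * T%:R :> R by rewrite defK natrM.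
have wK : w ^+ K <= x.
  have := bernoulli_upper K (ltW x0) (ltW x1); rewrite -/w KE.
  rewrite -mulrA (mulrC T%:R x) xT mulr1 => h.
  have : w ^+ K * T%:R <= 1.
    by have := exprn_ge0 K (ltW w0); nra.
  by rewrite -ler_pdivlMr // div1r.
have tK : K%:R * t ^+ K <= x.
  rewrite tE KE; apply: (@le_trans _ _ (T%:R * T%:R * x ^+ 4)).
    by rewrite ler_pM2l ?mulr_gt0 // lerXn2r ?nnegrE ?exprn_ge0 ?(ltW w0) ?(ltW x0).
  have -> : T%:R * T%:R * x ^+ 4 = (x * T%:R) ^+ 2 * x ^+ 2 by ring.
  by rewrite xT expr1n mul1r; nra.
have HK : `|harmonic_sum chi K| <= 2 * M%:R * x.
  apply: (le_trans hK); rewrite ler_wpM2l ?mulr_ge0 ?ler0n //.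
  by rewrite /x lef_pV2 ?posrE ?ltr0n // ler_nat leqW // defK leq_pmulr.
have low : Q%:R / 2 <= \sum_(1 <= m < K.+1) divisor_sum chi m * t ^+ m.
  apply: (@le_trans _ _ (\sum_(1 <= k < Q.+1) divisor_sum chi (k * k) * t ^+ (k * k))).
    have -> : Q%:R / 2 = \sum_(1 <= k < Q.+1) (2^-1 : R).
      by rewrite big_const_nat iter_addr_0 subn1 /= mulr_natl.
    apply: ler_sum_nat => k /andP [k0 kQ].
    have h1 := divisor_sum_square_ge1 hc k0.
    have h2 : 2^-1 <= t ^+ (k * k).
      have -> : t ^+ (k * k) = w ^+ (4 * (k * k)).
        by rewrite tE -exprM [in LHS]mulnC.
      apply: le_trans (bernoulli_lower _ (ltW x0) (ltW x1)).
      have : (4 * (k * k))%:R * 2 <= T%:R :> R.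
        by rewrite -natrM ler_nat defT mulnAC leq_mul2l /= leq_mul.
      set y := (4 * (k * k))%:R => h.
      have := ler_wpM2r (ltW x0) h; rewrite [_ * x in leRHS]mulrC xT.
      by lra.
    by apply: (@le_trans _ _ (1 * 2^-1)); [rewrite mul1r | apply: ler_pM; rewrite ?ler01 ?invr_ge0].
  apply: (@sum_squares_le _ (fun m => divisor_sum chi m * t ^+ m)).
    move=> m; apply: mulr_ge0; last by rewrite exprn_ge0 ?(ltW t0).
    exact: divisor_sum_ge0 hc.
  rewrite defK defT; apply: (@leq_trans (8 * (Q * Q))); first exact: leq_pmull.
  by rewrite leq_pmulr // -defT.
move: low; set S := \sum_(_ <= m < _) _ => low main.
have QE : Q%:R = 8 * M%:R + 3 :> R by rewrite defQ natrD natrM.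
have M0 : 0 <= M%:R :> R by [].
have d0 : 0 < 1 - t by lra.
have : (1 - t) * S <= (1 - t) * (4 * M%:R + 1).
  apply: (le_trans main).
  have : 2 * M%:R * x <= 2 * M%:R * (1 - t) by rewrite ler_wpM2l // mulr_ge0.
  by lra.
rewrite ler_pM2l //; lra.
Qed.

(** * Sums over primes *)

Lemma ln_nat_ge0 (R : realType) n : 0 <= ln n%:R :> R.
Proof.
case: n => [|n]; first by rewrite ln0.
by rewrite ln_ge0 // ler1n.
Qed.

Lemma ln_natM (R : realType) m n : (0 < m)%N -> (0 < n)%N ->
  ln (m * n)%:R = ln m%:R + ln n%:R :> R.
Proof. by move=> m0 n0; rewrite natrM lnM // posrE ltr0n. Qed.

Lemma ln_prod_nat (R : realType) (I : Type) (r : seq I) (P : pred I) (F : I -> nat) :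
  (forall i, P i -> (0 < F i)%N) ->
  ln (\prod_(i <- r | P i) F i)%:R = \sum_(i <- r | P i) ln (F i)%:R :> R.
Proof.
move=> F0; elim: r => [|i r IH]; first by rewrite !big_nil ln1.
rewrite !big_cons; case: ifP => // Pi; rewrite ln_natM ?IH ?F0 //.
by apply: prodn_cond_gt0.
Qed.

Lemma sum_leq_nat l N :
  (\sum_(1 <= j < N.+1) ((j <= l)%N : nat) = minn l N)%N.
Proof.
elim: N => [|N IH]; first by rewrite big_geq // minn0.
by rewrite big_nat_recr //= IH; lia.
Qed.

(** The von Mangoldt identity. Exponents [j] up to [N] are enough because [logn p n < n]. *)
Lemma ln_nat_pfactors (R : realType) n N : (0 < n <= N)%N ->
  ln n%:R = \sum_(1 <= p < N.+1 | prime p) \sum_(1 <= j < N.+1)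
              (if (p ^ j %| n)%N then ln p%:R else 0) :> R.
Proof.
case/andP => n0 nN; rewrite -{1}(partnT n0) (widen_partn _ nN).
rewrite ln_prod_nat; last first.
  by case=> [|p] _; rewrite ?logn0 expn_gt0 //= (lognE 0).
rewrite big_ltn_cond //= (lognE 0) /= ln1 add0r [RHS]big_mkcond /=.
apply: eq_bigr => p _; case: ifP => [pp|npp]; last first.
  by rewrite lognE npp /= ln1.
rewrite natrX lnXn ?ltr0n ?prime_gt0 //.
rewrite (eq_bigr (fun j => ln p%:R *+ (j <= logn p n)%N)); last first.
  by move=> j _; rewrite pfactor_dvdn //; case: leqP.
rewrite sumrMnr sum_leq_nat; congr (_ *+ _).
suff : (logn p n < n)%N by lia.
have [h|h] := posnP (logn p n); first by rewrite h.
apply: (@leq_trans (p ^ logn p n)); first by rewrite ltn_expl ?prime_gt1.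
by rewrite dvdn_leq // pfactor_dvdn.
Qed.

(** The weight 1 gives Legendre's formula for [ln N!]; the weight [chi n / n] gives the identity
    behind Mertens' estimate for characters. *)
Lemma weighted_ln_sum (R : realType) (w : nat -> R) N :
  \sum_(1 <= n < N.+1) w n * ln n%:R =
  \sum_(1 <= p < N.+1 | prime p) \sum_(1 <= j < N.+1)
    ln p%:R * \sum_(1 <= i < (N %/ p ^ j).+1) w (p ^ j * i)%N.
Proof.
transitivity (\sum_(1 <= n < N.+1) \sum_(1 <= p < N.+1 | prime p)
   \sum_(1 <= j < N.+1) (if (p ^ j %| n)%N then w n * ln p%:R else 0)).
  apply: eq_big_nat => n /andP [n0 nN]; rewrite (@ln_nat_pfactors _ n N) ?n0 //.
  rewrite big_distrr; apply: eq_bigr => p _; rewrite big_distrr; apply: eq_bigr => j _.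
  by rewrite /=; case: ifP => _; rewrite ?mulr0.
rewrite exchange_big; apply: eq_bigr => p pp.
rewrite exchange_big; apply: eq_bigr => j _.
rewrite -big_mkcond (sum_multiples N (fun n => w n * ln p%:R)).
  by rewrite big_distrr; apply: eq_bigr => i _; rewrite mulrC.
by rewrite expn_gt0 prime_gt0.
Qed.

Lemma ln_ratio_le (R : realType) n : (0 < n)%N ->
  ln n.+1%:R - ln n%:R <= n%:R^-1 :> R.
Proof.
move=> n0; have N0 : 0 < n%:R :> R by rewrite ltr0n.
rewrite -ln_div ?posrE ?ltr0n //.
have -> : n.+1%:R / n%:R = 1 + n%:R^-1 :> R.
  by rewrite -[n.+1]addn1 natrD mulrDl divff ?gt_eqF // mul1r.
apply: le_ln1Dx; have : 0 < n%:R^-1 :> R by rewrite invr_gt0.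
by lra.
Qed.

Lemma sum_ln_over_square_le (R : realType) N :
  \sum_(2 <= n < N.+1) ln n%:R / (n%:R * (n%:R - 1)) <= 2 :> R.
Proof.
(* A telescoping majorant: [(ln x + 1) / x] is the tail integral of [ln x / x^2], and the extra 1
   absorbs the discretisation. The constant 2 is [g 1]. *)
pose g n : R := (ln n%:R + 2) / n%:R.
suff h : forall N, \sum_(2 <= n < N.+2) ln n%:R / (n%:R * (n%:R - 1)) <= 2 - g N.+1.
  case: N => [|N]; first by rewrite big_geq //; lra.
  apply: (le_trans (h N)); rewrite gerBl divr_ge0 // addr_ge0 ?ln_nat_ge0 //.
elim=> [|n IH]; first by rewrite big_geq // /g ln1 add0r divr1 subrr.
rewrite big_nat_recr //=.
suff : ln n.+2%:R / (n.+2%:R * (n.+2%:R - 1)) <= g n.+1 - g n.+2.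
  move: IH; set A := \sum_(_ <= _ < _) _; set B := ln _ / _.
  by set g1 := g _; set g2 := g _; lra.
have r := @ln_ratio_le R n.+1 isT.
have e : n.+2%:R = n.+1%:R + 1 :> R by rewrite -[n.+2]addn1 natrD.
have N1 : 1 <= n.+1%:R :> R by rewrite ler1n.
rewrite /g; move: r; set a := ln n.+2%:R; set b := ln n.+1%:R; rewrite e addrK.
set x := n.+1%:R in N1 * => r.
have -> : (b + 2) / x - (a + 2) / (x + 1) = (a + 2 - (x + 1) * (a - b)) / ((x + 1) * x).
  by field; apply/andP; split; lra.
rewrite ler_pM2r ?invr_gt0 ?mulr_gt0 //; try lra.
have : (x + 1) * (a - b) <= 2.
  apply: (@le_trans _ _ ((x + 1) * x^-1)); first by rewrite ler_pM2l //; lra.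
  by rewrite ler_pdivrMr; lra.
by set y := _ * (a - b); lra.
Qed.

(** The geometric series over [j >= 2] is at most [1 / (p (p - 1))]; the primes are then enlarged to
    all integers from 2 on. *)
Lemma sum_prime_powers_le (R : realType) N :
  \sum_(1 <= p < N.+1 | prime p) \sum_(2 <= j < N.+1) ln p%:R * (p ^ j)%:R^-1
  <= 2 :> R.
Proof.
apply: le_trans (sum_ln_over_square_le R N).
have [->|N0] := posnP N; first by rewrite !big_geq.
rewrite big_mkcond big_ltn //= add0r; apply: ler_sum_nat => p /andP [p2 pN].
have p1 : 1 < p%:R :> R by rewrite ltr1n.
case: ifP => pp; last by rewrite divr_ge0 ?ln_nat_ge0 ?mulr_ge0 //; lra.
rewrite -big_distrr /= ler_wpM2l ?ln_nat_ge0 //.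
pose x : R := p%:R^-1.
have x0 : 0 < x by rewrite invr_gt0; lra.
have x1 : x < 1 by rewrite invf_lt1 //; lra.
have h n : (1 - x) * \sum_(2 <= j < n.+2) x ^+ j = x ^+ 2 - x ^+ n.+2.
  elim: n => [|n IH]; first by rewrite big_geq // mulr0 subrr.
  by rewrite big_nat_recr //= mulrDr IH (exprS x n.+2); ring.
under eq_bigr do rewrite natrX -exprVn -/x.
have -> : (p%:R * (p%:R - 1))^-1 = x ^+ 2 / (1 - x).
  by rewrite /x; field; do ?[apply/andP; split]; lra.
rewrite ler_pdivlMr ?subr_gt0 // mulrC.
case: N N0 {pN} => // N _; rewrite h; have : 0 < x ^+ N.+2 by rewrite exprn_gt0.
by lra.
Qed.

(** * Chebyshev's upper bound for the sum of [ln p] *)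

Lemma prod_primes_dvdn a b X :
  (forall p, (a <= p < b)%N -> prime p -> (p %| X)%N) ->
  (\prod_(a <= p < b | prime p) p %| X)%N.
Proof.
have [leba|ltab] := leqP b a; first by rewrite big_geq.
elim: b ltab => // b IH; rewrite ltnS => leab h.
have {}IH : (\prod_(a <= p < b | prime p) p %| X)%N.
  have [leba|ltab] := leqP b a; first by rewrite big_geq.
  by apply: IH => // p /andP [ap pb]; apply: h; lia.
rewrite big_mkcond big_nat_recr //= -big_mkcond; case: ifP => pb; last by rewrite muln1.
rewrite Gauss_dvd ?IH ?h ?leab //=.
rewrite coprime_sym prime_coprime // Euclid_dvd_prod // big_has_cond; apply/hasPn => p.
rewrite mem_index_iota /= => /andP [_ lt]; have [pp|//] := boolP (prime p).
by rewrite dvdn_prime2 // neq_ltn lt orbT.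
Qed.

Lemma bin_middle_le m : ('C(m.*2.+1, m) <= 4 ^ m)%N.
Proof.
have : ('C(m.*2.+1, m) + 'C(m.*2.+1, m.+1) <= 2 ^ m.*2.+1)%N.
  rewrite -[2%N]/(1 + 1)%N expnDn.
  have lt1 : (m < m.*2.+2)%N by lia.
  have lt2 : (m.+1 < m.*2.+2)%N by lia.
  rewrite (bigD1 (Ordinal lt1)) //= (bigD1 (Ordinal lt2)) /=; last first.
    by rewrite -val_eqE /= eqn_leq ltnn.
  by rewrite !exp1n !muln1; lia.
have -> : 'C(m.*2.+1, m.+1) = 'C(m.*2.+1, m).
  by rewrite -bin_sub; [congr ('C(_, _)); lia | lia].
by rewrite expnS -muln2 mulnC expnM -[(2 ^ 2)%N]/4%N; lia.
Qed.

(** Erdos' induction: for [n = 2 m + 1] the primes from [m + 2] to [n] divide the middle binomial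
    coefficient, which is at most [4 ^ m]; an even [n > 2] contributes no prime. *)
Lemma primorial_le n : (\prod_(1 <= p < n.+1 | prime p) p <= 4 ^ n)%N.
Proof.
have [k] := ubnP n; elim: k n => // k IH n ltnk.
have [/eqP e0|n0] := boolP (n == 0%N); first by rewrite e0 big_geq.
have [e2|n2] := eqVneq n 2%N; first by rewrite e2 unlock.
have [on|en] := boolP (odd n); last first.
  rewrite big_mkcond big_nat_recr //=; last by lia.
  rewrite -big_mkcond; have [pn|_] := boolP (prime n).
    by case: (even_prime pn) => [|o]; [lia | rewrite o in en].
  rewrite muln1; have -> : n = n.-1.+1 by lia.
  by apply: (leq_trans (IH n.-1 _)); rewrite ?leq_exp2l //; lia.
have [m em] : exists m, n = m.*2.+1 by exists n./2; lia.
have [m0|m0] := posnP m; first by rewrite em m0 unlock.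
rewrite em (@big_cat_nat _ _ _ m.+2) //=; last by lia.
have -> : (4 ^ m.*2.+1 = 4 ^ m.+1 * 4 ^ m)%N by rewrite -expnD; congr (_ ^ _)%N; lia.
apply: leq_mul; first by apply: IH; lia.
apply: leq_trans (bin_middle_le m); apply: dvdn_leq; first by rewrite bin_gt0; lia.
apply: prod_primes_dvdn => p /andP [p1 p2] pp.
have ndf i : (i < p)%N -> ~~ (p %| i`!)%N.
  elim: i => [|i IHi] lt; first by rewrite fact0 dvdn1; have := prime_gt1 pp; lia.
  by rewrite factS Euclid_dvdM // negb_or IHi 1?ltnW // gtnNdvd.
have : (p %| (m.*2.+1)`!)%N by rewrite dvdn_fact //; have := prime_gt0 pp; lia.
rewrite -(@bin_fact m.*2.+1 m); last by lia.
rewrite !Euclid_dvdM // => /or3P [//|h|h]; exfalso; move: h; apply/negP; apply: ndf; lia.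
Qed.

Lemma chebyshev_theta_le (R : realType) N :
  \sum_(1 <= p < N.+1 | prime p) ln p%:R <= 3 * N%:R :> R.
Proof.
rewrite -ln_prod_nat; last by move=> p; apply: prime_gt0.
have P0 : (0 < \prod_(1 <= p < N.+1 | prime p) p)%N.
  by apply: prodn_cond_gt0 => p; apply: prime_gt0.
apply: (@le_trans _ _ (ln (4 ^ N)%:R)).
  by rewrite ler_ln ?posrE ?ltr0n ?expn_gt0 // ler_nat primorial_le.
rewrite natrX lnXn // -[_ *+ N]mulr_natr ler_wpM2r //.
have := @le_ln1Dx R 3; have -> : 1 + 3 = 4 :> R by lra.
by apply; lra.
Qed.

(** * Primes with prescribed quadratic characters *)

Definition prime_char_sum (R : realType) (chi : nat -> R) (N : nat) : R :=
  \sum_(1 <= p < N.+1 | prime p) chi p * (ln p%:R / p%:R).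

Lemma fact_ln_ge (R : realType) N :
  N%:R * ln N%:R - N%:R <= \sum_(1 <= n < N.+1) ln n%:R :> R.
Proof.
elim: N => [|N IH]; first by rewrite big_geq // mul0r subr0.
have [->|N0] := posnP N; first by rewrite big_nat1 ln1 mulr0 sub0r oppr_le0.
rewrite big_nat_recr //=; have r := @ln_ratio_le R N N0.
have NR : 0 < N%:R :> R by rewrite ltr0n.
have : N%:R * (ln N.+1%:R - ln N%:R) <= 1 :> R.
  by rewrite mulrC -ler_pdivlMr // div1r.
have e : N.+1%:R = N%:R + 1 :> R by rewrite -[N.+1]addn1 natrD.
move: IH; set S := \sum_(_ <= _ < _) _; set a := ln N%:R; set b := ln N.+1%:R.
by rewrite e; set x := N%:R => IH h; lra.
Qed.

(** Comparing Stirling's lower bound for [ln N!] with its prime factorisation, where higher prime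
    powers cost at most [2 N], bounds the sum below by [ln N - 3]. *)
Lemma prime_sum_unbounded (R : realType) (C : R) :
  exists N, C < prime_char_sum (fun=> 1) N.
Proof.
have low N : (0 < N)%N -> ln N%:R - 3 <= prime_char_sum (fun=> 1) N :> R.
  move=> N0; have NR : 0 < N%:R :> R by rewrite ltr0n.
  rewrite -(ler_pM2l NR).
  have := fact_ln_ge R N; have := @weighted_ln_sum R (fun=> 1) N.
  under eq_bigr do rewrite mul1r.
  move=> ->.
  have up : \sum_(1 <= p < N.+1 | prime p) \sum_(1 <= j < N.+1)
     ln p%:R * \sum_(1 <= i < (N %/ p ^ j).+1) 1 <=
     N%:R * (prime_char_sum (fun=> 1) N + 2) :> R.
    apply: (@le_trans _ _ (N%:R * (prime_char_sum (fun=> 1) N +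
       \sum_(1 <= p < N.+1 | prime p) \sum_(2 <= j < N.+1) ln p%:R * (p ^ j)%:R^-1))).
      rewrite /prime_char_sum -big_split /= big_distrr /=.
      apply: ler_sum => p pp; rewrite big_ltn // mulrDr; apply: lerD.
        rewrite mul1r mulrCA; apply: ler_wpM2l; first exact: ln_nat_ge0.
        rewrite big_const_nat iter_addr_0 subn1 /= expn1 ler_pdivlMr ?ltr0n ?prime_gt0 //.
        by rewrite -natrM ler_nat leq_trunc_div.
      rewrite big_distrr /=; apply: ler_sum => j _.
      rewrite mulrCA; apply: ler_wpM2l; first exact: ln_nat_ge0.
      rewrite big_const_nat iter_addr_0 subn1 /= ler_pdivlMr ?ltr0n ?expn_gt0 ?prime_gt0 //.
      by rewrite -natrM ler_nat leq_trunc_div.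
    by rewrite ler_pM2l // lerD2l; apply: sum_prime_powers_le.
  move: up; set X := \sum_(_ <= _ < _ | _) _; set P := prime_char_sum _ _.
  by set l := ln _; set n := N%:R => h1 h2; lra.
have [k hk] : exists k : nat, C + 3 < k%:R / 2.
  exists (Num.bound `|(C + 3) * 2|); rewrite ltr_pdivlMr //.
  exact: le_lt_trans (ler_norm _) (archi_boundP (normr_ge0 _)).
(* For a power of two, the crude bound [ln 2 >= 1/2] suffices. *)
exists (2 ^ k)%N; have := low (2 ^ k)%N; rewrite expn_gt0 /= => /(_ isT).
have ln2 : 2^-1 <= ln 2 :> R.
  have := @le_ln1Dx R (- 2^-1); have -> : 1 - 2^-1 = 2^-1 :> R by lra.
  by rewrite lnV ?posrE //; lra.
rewrite natrX lnXn // -[_ *+ k]mulr_natr.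
have : 2^-1 * k%:R <= ln 2 * k%:R :> R by rewrite ler_wpM2r.
set a := ln 2 * _; set P := prime_char_sum _ _; lra.
Qed.

(** Monotonicity needs [ln n >= 1]. At 4 this follows from [ln 2 >= 1/2], which explains the
    threshold. *)
Lemma ln_over_n_decr (R : realType) n : (4 <= n)%N ->
  ln n.+1%:R / n.+1%:R <= ln n%:R / n%:R :> R.
Proof.
move=> n4; have n0 : (0 < n)%N by lia.
have NR : 0 < n%:R :> R by rewrite ltr0n.
have r := @ln_ratio_le R n n0.
have l1 : 1 <= ln n%:R :> R.
  have ln2 : 2^-1 <= ln 2 :> R.
    have := @le_ln1Dx R (- 2^-1); have -> : 1 - 2^-1 = 2^-1 :> R by lra.
    by rewrite lnV ?posrE //; lra.
  apply: (@le_trans _ _ (ln 4)); last by rewrite ler_ln ?posrE // (ler_nat _ 4).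
  have -> : 4 = 2 * 2 :> R by lra.
  by rewrite lnM ?posrE //; lra.
rewrite ler_pdivrMr ?ltr0n // mulrAC ler_pdivlMr //.
have e : n.+1%:R = n%:R + 1 :> R by rewrite -[n.+1]addn1 natrD.
have : n%:R * (ln n.+1%:R - ln n%:R) <= 1 :> R.
  by rewrite mulrC -ler_pdivlMr // div1r.
rewrite e in r *; move: r l1; set a := ln _; set b := ln _; set x := n%:R in NR *.
by move=> _ l1 h; nra.
Qed.

Lemma char_ln_sum_bounded (R : realType) M (chi : nat -> R) :
  real_character M chi ->
  exists C, forall N, `|\sum_(1 <= n < N.+1) chi n * n%:R^-1 * ln n%:R| <= C.
Proof.
move=> hc.
pose S N : R := \sum_(1 <= n < N.+1) chi n * n%:R^-1 * ln n%:R.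
exists (`|S 0%N| + `|S 1%N| + `|S 2%N| + `|S 3%N| + 2 * M%:R * (ln 4 / 4)) => N.
have M0 : 0 <= 2 * M%:R * (ln 4 / 4) :> R.
  by rewrite !mulr_ge0 ?invr_ge0 ?(ln_nat_ge0 R 4).
have g i := normr_ge0 (S i).
rewrite -/(S N); have := g 0%N; have := g 1%N; have := g 2%N; have := g 3%N.
have [N3|N3] := leqP N 3; first by case: N N3 => [|[|[|[|]]]] // _; lra.
have -> : S N = S 3%N + \sum_(4 <= n < N.+1) chi n * (ln n%:R / n%:R).
  rewrite /S (@big_cat_nat _ _ _ 4 1 N.+1) //=; last by rewrite ltnW.
  congr (_ + _).
  by apply: eq_bigr => n _; rewrite -mulrA [_^-1 * _]mulrC.
have tail : `|\sum_(4 <= n < N.+1) chi n * (ln n%:R / n%:R)| <= 2 * M%:R * (ln 4 / 4).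
  apply: (@abel_summation_le _ chi (fun n => ln n%:R / n%:R)) => //.
  - by move=> c; apply: char_interval_sum_le.
  - by move=> i _; rewrite divr_ge0 ?ln_nat_ge0.
  - by move=> i; apply: ln_over_n_decr.
  - by rewrite ltnW.
have := ler_normD (S 3%N) (\sum_(4 <= n < N.+1) chi n * (ln n%:R / n%:R)).
by set T := 2 * M%:R * _ in tail M0 *; lra.
Qed.

(** Insert the von Mangoldt identity into the bounded sum of [chi n * ln n / n]: the primes give
    [A], the higher powers a bounded [B]. It remains to replace the harmonic sum up to [N %/ p] by
    the one up to [N]. *)
Lemma prime_char_sum_times_harmonic (R : realType) M (chi : nat -> R) :
  real_character M chi ->
  exists C, forall N, `|harmonic_sum chi N * prime_char_sum chi N| <= C.
Proof.
move=> hc; have [C0 hC0] := char_ln_sum_bounded hc.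
exists (C0 + 4 * M%:R + 6 * M%:R) => N.
have [->|N0] := posnP N.
  rewrite /prime_char_sum big_geq // mulr0 normr0.
  by have := le_trans (normr_ge0 _) (hC0 0%N); have : 0 <= M%:R :> R by []; lra.
have NR : 0 < N%:R :> R by rewrite ltr0n.
have inner p j : (0 < p)%N -> \sum_(1 <= i < (N %/ p ^ j).+1)
    chi (p ^ j * i)%N * (p ^ j * i)%:R^-1 =
    chi p ^+ j * (p ^ j)%:R^-1 * harmonic_sum chi (N %/ p ^ j).
  move=> p0; rewrite /harmonic_sum big_distrr; apply: eq_bigr => i _ /=.
  by rewrite (char_mul hc) (char_exp _ _ hc) natrM invfM; ring.
have := hC0 N; rewrite weighted_ln_sum.
pose A := \sum_(1 <= p < N.+1 | prime p)
   chi p * (ln p%:R / p%:R) * harmonic_sum chi (N %/ p).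
pose B := \sum_(1 <= p < N.+1 | prime p) \sum_(2 <= j < N.+1)
   ln p%:R * (chi p ^+ j * (p ^ j)%:R^-1 * harmonic_sum chi (N %/ p ^ j)).
have -> : \sum_(1 <= p < N.+1 | prime p) \sum_(1 <= j < N.+1)
    ln p%:R * \sum_(1 <= i < (N %/ p ^ j).+1) chi (p ^ j * i)%N * (p ^ j * i)%:R^-1
    = A + B.
  rewrite /A /B -big_split /=; apply: eq_bigr => p pp.
  rewrite big_ltn //; congr (_ + _).
    by rewrite inner ?prime_gt0 // expn1 expr1; ring.
  by apply: eq_bigr => j _; rewrite inner ?prime_gt0.
move=> hAB.
have Hb K := harmonic_sum_le K hc.
have hB : `|B| <= 4 * M%:R.
  apply: (@le_trans _ _ (2 * M%:R * \sum_(1 <= p < N.+1 | prime p)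
      \sum_(2 <= j < N.+1) ln p%:R * (p ^ j)%:R^-1)); last first.
    have -> : 4 * M%:R = 2 * M%:R * 2 :> R by ring.
    by rewrite ler_wpM2l ?mulr_ge0 // sum_prime_powers_le.
  apply: (le_trans (ler_norm_sum _ _ _)); rewrite big_distrr /=.
  apply: ler_sum => p pp; apply: (le_trans (ler_norm_sum _ _ _)).
  rewrite big_distrr /=; apply: ler_sum => j _.
  rewrite !normrM (ger0_norm (ln_nat_ge0 R p)) normrX normfV normr_nat.
  have h1 : `|chi p| ^+ j <= 1 by rewrite exprn_ile1 ?char_norm_le1 // (char_norm_le1 _ hc).
  rewrite [leRHS]mulrCA ler_wpM2l ?ln_nat_ge0 //.
  rewrite mulrAC ler_wpM2r ?invr_ge0 //.
  by rewrite -[leRHS]mul1r; apply: ler_pM; rewrite ?exprn_ge0.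
(* The tail bound turns each replacement into at most [2 M ln p / N], and Chebyshev's estimate makes
   the total at most [6 M]. *)
have hD : `|harmonic_sum chi N * prime_char_sum chi N - A| <= 6 * M%:R.
  rewrite /prime_char_sum /A big_distrr -sumrB /=.
  apply: (@le_trans _ _ (2 * M%:R * N%:R^-1 *
      \sum_(1 <= p < N.+1 | prime p) ln p%:R)); last first.
    have -> : 6 * M%:R = 2 * M%:R * N%:R^-1 * (3 * N%:R) :> R.
      by field; rewrite gt_eqF.
    by rewrite ler_wpM2l ?mulr_ge0 ?invr_ge0 // chebyshev_theta_le.
  apply: (le_trans (ler_norm_sum _ _ _)); rewrite big_distrr /=.
  apply: ler_sum => p pp; have p0 := prime_gt0 pp.
  rewrite [X in `|X - _|]mulrC -mulrBr !normrM.
  have PR : 0 < p%:R :> R by rewrite ltr0n.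
  have h1 := char_norm_le1 p hc.
  have h2 := harmonic_tail_le hc (leq_div N p).
  rewrite (ger0_norm (ln_nat_ge0 R p)) normfV normr_nat.
  apply: (@le_trans _ _ (1 * (ln p%:R / p%:R) * (2 * M%:R * (N %/ p).+1%:R^-1))).
    apply: ler_pM => //; first by rewrite !mulr_ge0 ?ln_nat_ge0 ?invr_ge0.
    by apply: ler_wpM2r => //; rewrite mulr_ge0 ?ln_nat_ge0 ?invr_ge0.
  have -> : 1 * (ln p%:R / p%:R) * (2 * M%:R * (N %/ p).+1%:R^-1) =
     2 * M%:R * ln p%:R * (p%:R * (N %/ p).+1%:R)^-1 :> R.
    by rewrite invfM; ring.
  rewrite [leRHS]mulrAC ler_wpM2l ?mulr_ge0 ?ln_nat_ge0 //.
  rewrite lef_pV2 ?posrE ?mulr_gt0 ?ltr0n // -natrM ler_nat mulnC.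
  by rewrite ltnW // -ltn_divLR.
have -> : harmonic_sum chi N * prime_char_sum chi N =
   (harmonic_sum chi N * prime_char_sum chi N - A) + (A + B) - B by ring.
move: hB hD hAB; set X := _ - A; set Y := A + B => hB hD hAB.
apply: (le_trans (ler_normB _ _)); have := ler_normD X Y; lra.
Qed.

(** From [K] on the harmonic sum has absolute value at least [c > 0] and can be divided out; for
    smaller [N] the trivial bound [D] serves. *)
Lemma prime_char_sum_bounded (R : realType) M (chi : nat -> R) :
  real_character M chi -> exists C, forall N, `|prime_char_sum chi N| <= C.
Proof.
move=> hc; have [C hC] := prime_char_sum_times_harmonic hc.
have [K hK] := harmonic_sum_nonvanishing hc.
pose c := `|harmonic_sum chi K| - 2 * M%:R * K.+1%:R^-1.
have c0 : 0 < c by rewrite subr_gt0.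
pose D := \sum_(1 <= p < K.+1 | prime p) ln p%:R / p%:R : R.
have C0 : 0 <= C by apply: le_trans (normr_ge0 _) (hC 0%N).
have term0 (p : nat) : 0 <= ln p%:R / p%:R :> R by rewrite divr_ge0 ?ln_nat_ge0.
have D0 : 0 <= D by apply: sumr_ge0.
exists (C / c + D) => N; have [leKN|ltNK] := leqP K N.
  apply: (@le_trans _ _ (C / c)); last by rewrite lerDl.
  rewrite ler_pdivlMr //; apply: le_trans (hC N); rewrite normrM mulrC.
  apply: ler_wpM2r => //.
  have := harmonic_tail_le hc leKN; rewrite /c.
  set HN := harmonic_sum chi N; set HK := harmonic_sum chi K.
  have := ler_normB HN (HN - HK); have -> : HN - (HN - HK) = HK by ring.
  set e := 2 * _ * _; lra.
apply: (@le_trans _ _ D); last by rewrite lerDr divr_ge0 // ltW.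
apply: (le_trans (ler_norm_sum _ _ _)).
apply: (@le_trans _ _ (\sum_(1 <= p < N.+1 | prime p) ln p%:R / p%:R)).
  apply: ler_sum => p _; rewrite normrM (ger0_norm (term0 p)) -[leRHS]mul1r.
  by apply: ler_wpM2r => //; apply: char_norm_le1 hc.
rewrite /D (@big_cat_nat _ _ _ N.+1 1 K.+1) //=; last by rewrite ltnW.
by rewrite lerDl sumr_ge0.
Qed.

Lemma eqn_modMl_coprime a m n d : coprime a d ->
  (a * m == a * n %[mod d])%N = (m == n %[mod d])%N.
Proof.
move=> cop; wlog le : m n / (n <= m)%N.
  by move=> h; case: (leqP n m) => [/h //|/ltnW /h]; rewrite eq_sym => ->; rewrite eq_sym.
rewrite !eqn_mod_dvd ?leq_mul2l ?le ?orbT // -mulnBr Gauss_dvdr // coprime_sym //.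
Qed.

(* If no prime had the prescribed signs, expanding [\prod_i (1 + eps i * chi i p)]
   would bound the divergent sum of [ln p / p] by finitely many bounded
   character sums. *)
Lemma exists_prime_with_signs (I : finType) (M : nat) (chi : I -> nat -> int)
    (eps : I -> int) :
  (0 < M)%N ->
  (forall i n, chi i (n + M)%N = chi i n) ->
  (forall i m n, chi i (m * n)%N = chi i m * chi i n) ->
  (forall i, chi i 1%N = 1) ->
  (forall i n, is_sign0 (chi i n)) ->
  (forall i n, (chi i n == 0) = ~~ coprime n M) ->
  (forall i, exists2 a, chi i a = -1 & forall j, j != i -> chi j a = 1) ->
  (forall i, eps i = 1 \/ eps i = -1) ->
  exists2 q, prime q & forall i, chi i q = eps i.
Proof.
move=> M0 per mul one sgn0 zero indep heps.
have [[q [qq hq]]|none] := pselect (exists q, prime q /\ forall i, chi i q = eps i).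
  by exists q.
pose R : realType := Rdefinitions.R.
pose X (S : {set I}) (n : nat) : R := (\prod_(i in S) chi i n)%:~R.
have Xchar (S : {set I}) : S != set0 -> real_character M (X S).
  case/set0Pn => i iS; split=> //.
  - by move=> n; rewrite /X; congr (_%:~R); apply: eq_bigr.
  - move=> m n; rewrite /X -rmorphM /= -big_split; congr (_%:~R).
    by apply: eq_bigr => j _; exact: mul.
  - by rewrite /X big1 // => j _.
  - move=> n; have : is_sign0 (\prod_(j in S) chi j n).
      by elim/big_rec: _ => [//|j x jS hx]; apply: is_sign0M.
    rewrite /X /is_sign0 !inE => /or3P [] /eqP->.
    + by constructor 1.
    + by constructor 2.
    + by constructor 3; rewrite mulrNz.
  - have [a ai aj] := indep i.
    have Xa : X S a = -1.
      rewrite /X (bigD1 i) //= big1 ?mulr1 ?ai ?mulrNz // => j /andP [_ ji].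
      exact: aj.
    have copa : coprime a M by have := zero i a; rewrite ai /=; case: coprime.
    have Xmod n : X S (n %% M)%N = X S n.
      rewrite {2}(divn_eq n M) addnC; elim: (n %/ M)%N => [|k IH].
        by rewrite mul0n addn0.
      rewrite mulSn addnCA addnC IH /X; congr (_%:~R); apply: eq_bigr => j _.
      by rewrite per.
    rewrite big_mkord; set T := \sum_(i < M) _.
    (* Multiplication by [a] permutes the residues modulo [M], and [X S a = -1] because exactly one
       factor of the product is negative at [a]. Hence [T = - T]. *)
    suff : T = X S a * T by rewrite Xa; lra.
    pose f (i : 'I_M) : 'I_M := Ordinal (ltn_pmod (a * i) M0).
    have finj : injective f.
      move=> x y /(congr1 val) /= /eqP e; apply: val_inj => /=.
      move: e; rewrite eqn_modMl_coprime //.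
      by rewrite !modn_small ?ltn_ord // => /eqP.
    rewrite {1}/T (reindex_inj finj) /T big_distrr; apply: eq_bigr => x _ /=.
    rewrite Xmod /X -rmorphM -big_split; congr (_%:~R).
    by apply: eq_bigr => j _; exact: mul.
have [C hC] : exists C : {set I} -> R, forall S N, S != set0 ->
    `|prime_char_sum (X S) N| <= C S.
  have [C hC] : exists C : {set I} -> R, forall S, S != set0 -> forall N,
      `|prime_char_sum (X S) N| <= C S.
    apply: (@fin_all_exists _ (fun=> R) (fun S c => S != set0 -> forall N,
      `|prime_char_sum (X S) N| <= c)) => S.
    have [->|Sn] := eqVneq S set0; first by exists 0.
    by have [C hC] := prime_char_sum_bounded (Xchar S Sn); exists C.
  by exists C => S N Sn; apply: hC.
pose D : R := \sum_(1 <= p < M.+1 | prime p) ln p%:R / p%:R.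
have [N hN] := @prime_sum_unbounded R (D + \sum_(S : {set I} | S != set0) C S).
exfalso; move: hN; apply/negP; rewrite -leNgt.
pose E (S : {set I}) : R := (\prod_(i in S) eps i)%:~R.
have term0 (p : nat) : 0 <= ln p%:R / p%:R :> R by rewrite divr_ge0 ?ln_nat_ge0.
have expand p : prime p ->
    \sum_(S : {set I}) E S * X S p = (if coprime p M then 0 else 1) :> R.
  move=> pp.
  have -> : \sum_(S : {set I}) E S * X S p = (\prod_i (eps i * chi i p + 1))%:~R.
    rewrite bigA_distr /= raddf_sum /=; apply: eq_bigr => S _.
    rewrite /E /X -rmorphM -big_split /=; congr (_%:~R).
    by rewrite big_mkcond.
  case: ifP => cop.
    have [i /eqP hi] : exists i, chi i p != eps i.
      apply/existsP; apply: contra_notT none => /existsPn h; exists p; split=> // i.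
      by apply/eqP; have := h i; rewrite negbK.
    rewrite (bigD1 i) //=; suff -> : eps i * chi i p + 1 = 0 by rewrite mul0r.
    have := sgn0 i p; have := zero i p; rewrite cop /= /is_sign0 !inE.
    by case: (heps i) hi => -> hi c /or3P [] /eqP e; rewrite e // in hi c *.
  rewrite big1 // => i _; have := zero i p; rewrite cop => /eqP->.
  by rewrite mulr0 add0r.
(* Under the contrary assumption the expanded product vanishes at each prime coprime to [M] and is 1
   at the others, which are at most [M]. Their total weight is at most [D]. *)
have key : prime_char_sum (fun=> 1) N +
    \sum_(S : {set I} | S != set0) E S * prime_char_sum (X S) N <= D.
  have -> : prime_char_sum (fun=> 1) N +
      \sum_(S : {set I} | S != set0) E S * prime_char_sum (X S) N =
    \sum_(1 <= p < N.+1 | prime p) (if coprime p M then 0 else 1) * (ln p%:R / p%:R).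
    have -> : prime_char_sum (fun=> 1) N = E set0 * prime_char_sum (X set0) N.
      rewrite /E big_set0 mul1r /prime_char_sum; apply: eq_bigr => p _.
      by rewrite /X big_set0.
    have -> : E set0 * prime_char_sum (X set0) N +
      \sum_(S : {set I} | S != set0) E S * prime_char_sum (X S) N =
      \sum_(S : {set I}) E S * prime_char_sum (X S) N by rewrite [RHS](bigD1 set0).
    rewrite /prime_char_sum; under eq_bigr do rewrite big_distrr.
    rewrite exchange_big /=; apply: eq_bigr => p pp; rewrite -expand // big_distrl.
    by apply: eq_bigr => S _ /=; rewrite mulrA.
  pose F p : R :=
    if prime p then (if coprime p M then 0 else 1) * (ln p%:R / p%:R) else 0.
  have F0 p : 0 <= F p.
    by rewrite /F; case: ifP => // _; case: ifP => // _; rewrite ?mul0r ?mul1r.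
  rewrite big_mkcond -/F; apply: (@le_trans _ _ (\sum_(1 <= p < (N + M).+1) F p)).
    rewrite (@big_cat_nat _ _ _ N.+1 1 (N + M).+1) //= ?lerDl ?sumr_ge0 //.
    by rewrite ltnS leq_addr.
  rewrite (@big_cat_nat _ _ _ M.+1 1 (N + M).+1) //=; last by rewrite ltnS leq_addl.
  rewrite [X in _ + X]big_nat [X in _ + X]big1 ?addr0.
    rewrite /D [leRHS]big_mkcond; apply: ler_sum => p _; rewrite /F.
    by case: ifP => // _; case: ifP => // _; rewrite ?mul0r ?mul1r.
  move=> p /andP [lp _]; rewrite /F; case: ifP => // pp.
  suff -> : coprime p M by rewrite mul0r.
  by rewrite prime_coprime // gtnNdvd.
have Eb S : `|E S| = 1.
  rewrite /E -intr_norm; suff -> : `|\prod_(i in S) eps i| = 1 by [].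
  by rewrite normr_prod big1 // => i _; case: (heps i) => ->.
have : - \sum_(S : {set I} | S != set0) E S * prime_char_sum (X S) N
   <= \sum_(S : {set I} | S != set0) C S.
  rewrite -sumrN; apply: ler_sum => S Sn.
  apply: (le_trans (ler_norm _)); rewrite normrN normrM Eb mul1r; exact: hC.
move: key; set A := prime_char_sum _ _; set B := \sum_(S | _) E _ * _.
set B' := \sum_(S | _) C _; lra.
Qed.

(** * Ternary forms *)

(** Pigeonhole: the box has more points than there are pairs of residues modulo [m] and [t], and the
    difference of two colliding points is the solution. *)
Lemma small_solution_of_congruences (m t X Y W : nat) (a b : int) :
  (0 < m)%N -> (0 < t)%N -> (m * t < X.+1 * Y.+1 * W.+1)%N ->
  exists x y w : int,
    [/\ (`|x| <= X)%N, (`|y| <= Y)%N, (`|w| <= W)%N,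
        ~ [/\ x = 0, y = 0 & w = 0] &
        (m%:Z %| x - a * y)%Z /\ (t%:Z %| x - b * w)%Z].
Proof.
case: m => // m _; case: t => // t _ lt_mt.
pose r (d : nat) (z : int) : 'I_d.+1 := inord `|(z %% d.+1%:Z)%Z|%N.
pose f (v : 'I_X.+1 * 'I_Y.+1 * 'I_W.+1) : 'I_m.+1 * 'I_t.+1 :=
  (r m (v.1.1%:Z - a * v.1.2%:Z), r t (v.1.1%:Z - b * v.2%:Z)).
have rE d z z' : r d z = r d z' -> (d.+1%:Z %| z - z')%Z.
  move/(congr1 (@nat_of_ord _)); rewrite /r !inordK; try lia.
  by move=> e; rewrite -eqz_mod_dvd; apply/eqP; lia.
have /injectivePn [[[i j] k] [[[i' j'] k'] ne]] : ~~ injectiveb f.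
  apply/negP => /injectiveP /leq_card; rewrite !card_prod !card_ord => le.
  by move: lt_mt; rewrite ltnNge le.
case=> /rE /= e1 /rE /= e2.
exists (i%:Z - i'%:Z), (j%:Z - j'%:Z), (k%:Z - k'%:Z).
have := ltn_ord i; have := ltn_ord i'; have := ltn_ord j; have := ltn_ord j'.
have := ltn_ord k; have := ltn_ord k'.
move=> lk' lk lj' lj li' li; split; try lia.
- case=> ei ej ek; case/eqP: ne; congr (_, _, _); apply: val_inj => /=; lia.
- split.
  + by have -> : i%:Z - i'%:Z - a * (j%:Z - j'%:Z) =
      i%:Z - a * j%:Z - (i'%:Z - a * j'%:Z) by ring.
  + by have -> : i%:Z - i'%:Z - b * (k%:Z - k'%:Z) =
      i%:Z - b * k%:Z - (i'%:Z - b * k'%:Z) by ring.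
Qed.

Lemma sqr_absz_mul (x : int) : x ^+ 2 = (`|x| * `|x|)%N%:Z.
Proof. by rewrite PoszM abszE -expr2 real_normK ?num_real. Qed.

Lemma exists_isqrt (n : nat) : exists s : nat, (s * s <= n < s.+1 * s.+1)%N.
Proof.
elim: n => [|n [s /andP [le lt]]]; first by exists 0%N.
have [e|ne] := eqVneq n.+1 (s.+1 * s.+1)%N; [exists s.+1 | exists s]; nia.
Qed.

Lemma not_square_of_odd_logn (p t : nat) :
  odd (logn p t) -> forall s : nat, (s * s)%N != t.
Proof.
move=> ot s; apply: contraTneq ot => <-.
have [->|s0] := posnP s; first by rewrite logn0.
by rewrite lognM // oddD addbb.
Qed.

(** Thue's argument, run in the ternary box with second modulus 1 and [W = 0]. As [q] is not a
    square, [x ^+ 2 + y ^+ 2] is a multiple of [q] strictly between 0 and [2 q]. *)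
Lemma two_squares_of_sqr_mod (q : nat) (a : int) :
  prime q -> (q%:Z %| a ^+ 2 + 1)%Z ->
  exists x y : int, q%:Z = x ^+ 2 + y ^+ 2.
Proof.
move=> pq da; have [s /andP [les lts]] := exists_isqrt q.
have q0 := prime_gt0 pq; have q1 := prime_gt1 pq.
have nsq : (s * s)%N != q.
  by apply: (@not_square_of_odd_logn q); rewrite logn_prime ?eqxx.
have [||x [y [w [lx ly lw ne [d1 _]]]]] :=
    @small_solution_of_congruences q 1 s s 0 a 0 q0; [by []|lia|].
have /dvdzP [k ek] : (q%:Z %| x ^+ 2 + y ^+ 2)%Z.
  have -> : x ^+ 2 + y ^+ 2 = (x + a * y) * (x - a * y) + y ^+ 2 * (a ^+ 2 + 1).
    by ring.
  by apply: rpredD; apply: dvdz_mull.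
exists x, y; have w0 : w = 0 by lia.
have nz : x <> 0 \/ y <> 0.
  by have [x0|/eqP xn] := eqVneq x 0; [right=> y0; apply: ne|left].
have hx : x ^+ 2 < q%:Z by have := leq_mul lx lx; lia.
have hy : y ^+ 2 < q%:Z by have := leq_mul ly ly; lia.
have pos : 0 < k * q%:Z.
  rewrite -ek; have := sqr_ge0 x; have := sqr_ge0 y.
  by case: nz => /eqP; rewrite -sqrf_eq0 => /eqP; lia.
have lt2 : k * q%:Z < 2 * q%:Z by rewrite -ek; lia.
have k1 : k = 1.
  rewrite pmulr_lgt0 // in pos; rewrite ltr_pM2r // in lt2.
  by lia.
by rewrite ek k1 mul1r.
Qed.

(** The congruences make [v] divisible by [m t], and the size of the box puts it strictly between
    [- m t] and [2 m t]. So [v] is 0 or [m t], and the second case is repaired by an identity. *)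
Lemma legendre_ternary (m t : nat) (a b : int) :
  (0 < m)%N -> (forall s, (s * s)%N != t) ->
  (m%:Z %| a ^+ 2 + t%:Z)%Z -> (t%:Z %| b ^+ 2 - m%:Z)%Z -> coprime m t ->
  exists x y w : int, 0 < w /\ x ^+ 2 + t%:Z * y ^+ 2 = m%:Z * w ^+ 2.
Proof.
move=> m0 nsq da db cop.
have t0 : (0 < t)%N by rewrite lt0n eq_sym; apply: (nsq 0%N).
have [X /andP [leX ltX]] := exists_isqrt (m * t).
have [Y /andP [leY ltY]] := exists_isqrt m.
have [W /andP [leW ltW]] := exists_isqrt t.
have big : (m * t < X.+1 * Y.+1 * W.+1)%N.
  rewrite -ltn_sqr; have := ltn_mul ltX (ltn_mul ltY ltW).
  by congr (_ < _)%N; ring.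
have [x [y [w [lx ly lw ne [d1 d2]]]]] :=
    @small_solution_of_congruences m t X Y W a b m0 t0 big.
pose v := x ^+ 2 + t%:Z * y ^+ 2 - m%:Z * w ^+ 2.
have dm : (m%:Z %| v)%Z.
  have -> : v = (x + a * y) * (x - a * y) + y ^+ 2 * (a ^+ 2 + t%:Z)
              - w ^+ 2 * m%:Z by rewrite /v; ring.
  by apply: rpredB; rewrite ?rpredD ?dvdz_mull.
have dt : (t%:Z %| v)%Z.
  have -> : v = (x + b * w) * (x - b * w) + w ^+ 2 * (b ^+ 2 - m%:Z)
              + y ^+ 2 * t%:Z by rewrite /v; ring.
  by rewrite !rpredD ?dvdz_mull.
have /dvdzP [k ek] : (m%:Z * t%:Z %| v)%Z by rewrite Gauss_dvdz ?dm ?dt.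
have wlt : w ^+ 2 < t%:Z.
  by rewrite sqr_absz_mul ltz_nat ltn_neqAle nsq (leq_trans (leq_mul lw lw)).
have xle : x ^+ 2 <= m%:Z * t%:Z.
  by rewrite sqr_absz_mul -PoszM lez_nat (leq_trans (leq_mul lx lx)).
have yle : y ^+ 2 <= m%:Z.
  by rewrite sqr_absz_mul lez_nat (leq_trans (leq_mul ly ly)).
move: lx ly lw ne d1 d2 dm dt ek leX leY leW ltX ltY ltW big da db => _ _ _.
move=> ne _ _ _ _ ek _ _ _ _ _ _ _ _ _.
(* Both terms are at most [m t]. Equality in both would give [y ^+ 2 = m] and [x ^+ 2 = m t], making
   [t] a square. *)
have xylt : x ^+ 2 + t%:Z * y ^+ 2 < 2 * (m%:Z * t%:Z).
  have tyle : t%:Z * y ^+ 2 <= t%:Z * m%:Z by rewrite ler_pM2l.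
  have [ex|nex] := eqVneq (x ^+ 2) (m%:Z * t%:Z); last first.
    have : x ^+ 2 < m%:Z * t%:Z by rewrite lt_neqAle nex.
    by clear -tyle; lra.
  have [ey|] := eqVneq (y ^+ 2) m%:Z; last first.
    move=> ney; have : t%:Z * y ^+ 2 < t%:Z * m%:Z.
      by rewrite ltr_pM2l // lt_neqAle ney.
    by clear -xle; lra.
  have ey' : (`|y| * `|y|)%N = m by apply/eqP; rewrite -eqz_nat -sqr_absz_mul ey.
  have ex' : (`|x| * `|x|)%N = (m * t)%N.
    by apply/eqP; rewrite -eqz_nat -sqr_absz_mul ex PoszM.
  have /dvdnP [z ez] : (`|y| %| `|x|)%N.
    by rewrite -(@dvdn_pexp2r _ _ 2) // !expnS !expn0 !muln1 ex' ey' dvdn_mulr.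
  case/negP: (nsq z); rewrite -(@eqn_pmul2l m) // -ex' ez -ey'; apply/eqP; ring.
have mw : m%:Z * w ^+ 2 < m%:Z * t%:Z by rewrite ltr_pM2l.
have mw0 : 0 <= m%:Z * w ^+ 2 by rewrite mulr_ge0 ?sqr_ge0.
have ty0 : 0 <= t%:Z * y ^+ 2 by rewrite mulr_ge0 ?sqr_ge0.
have mt0 : 0 < m%:Z * t%:Z by rewrite mulr_gt0.
have x0 := sqr_ge0 x.
have klo : - 1 < k.
  by rewrite -(ltr_pM2r mt0) -ek /v; clear -mw ty0 x0; lra.
have khi : k < 2.
  by rewrite -(ltr_pM2r mt0) -ek /v; clear -mw0 xylt; lra.
have [k0|k1] : k = 0 \/ k = 1 by clear -klo khi; lia.
- exists x, y, `|w|; rewrite real_normK ?num_real //.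
  have e : x ^+ 2 + t%:Z * y ^+ 2 = m%:Z * w ^+ 2.
    by apply/eqP; rewrite -subr_eq0 -/v ek k0 mul0r.
  split=> //; rewrite normr_gt0; apply/negP => /eqP w0.
  rewrite w0 expr0n /= mulr0 in e.
  have /eqP : x ^+ 2 = 0 by clear -e x0 ty0; lra.
  have /eqP : t%:Z * y ^+ 2 = 0 by clear -e x0 ty0; lra.
  rewrite mulf_eq0 !sqrf_eq0; case/orP=> [|/eqP y0 /eqP xz].
    by rewrite eqz_nat => /eqP tz; rewrite tz in t0.
  by case: ne.
(* Here [x^2 + t y^2 = m (w^2 + t)]. Multiplying [x + y sqrt(-t)] by [w + sqrt(-t)], whose norm is
   [w^2 + t], turns the right side into [m] times a square. *)
- exists (x * w - t%:Z * y), (x + w * y), (w ^+ 2 + t%:Z); split.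
    by rewrite ltr_wpDl ?sqr_ge0.
  have e : x ^+ 2 + t%:Z * y ^+ 2 = m%:Z * (w ^+ 2 + t%:Z).
    by rewrite mulrDr -[m%:Z * t%:Z]mul1r -k1 -ek /v; ring.
  transitivity ((x ^+ 2 + t%:Z * y ^+ 2) * (w ^+ 2 + t%:Z)); first by ring.
  by rewrite e; ring.
Qed.

Lemma exists_nearest (x w : int) :
  0 < w -> exists y : int, (2 * (x - w * y)) ^+ 2 <= w ^+ 2.
Proof.
move=> w0; exists ((2 * x + w) %/ (2 * w))%Z.
have := divz_eq (2 * x + w) (2 * w).
have := @ltz_mod (2 * x + w) (2 * w); have := @modz_ge0 (2 * x + w) (2 * w).
set d := divz _ _; set r := modz _ _ => r0 r1 e.
have {}r0 : 0 <= r by apply: r0; lia.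
have {}r1 : r < 2 * w by lia.
have -> : 2 * (x - w * d) = r - w by lia.
by nia.
Qed.

(* The line through a rational point and a nearest integer point meets the
   sphere again at a point with a smaller denominator. *)
Lemma aubry (n x y z w : int) :
  0 < w -> x ^+ 2 + y ^+ 2 + z ^+ 2 = n * w ^+ 2 -> sum_of_three_squares n.
Proof.
have [k] := ubnP `|w|%N; elim: k x y z w => // k IH x y z w lw w0 e.
have [a ha] := exists_nearest x w0.
have [b hb] := exists_nearest y w0.
have [c hc] := exists_nearest z w0.
(* The new denominator is [w] times the squared distance from the rational point to the chosen
   integer point. Each coordinate is off by at most 1/2, so this distance squared is at most 3/4. *)
have [w' w'E] : {w' | w' = n * w - 2 * (x * a + y * b + z * c)
    + w * (a ^+ 2 + b ^+ 2 + c ^+ 2)} by eexists.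
have ew : w * w' = (x - w * a) ^+ 2 + (y - w * b) ^+ 2 + (z - w * c) ^+ 2.
  apply/eqP; rewrite -subr_eq0 (_ : _ - _ = n * w ^+ 2 - (x ^+ 2 + y ^+ 2 + z ^+ 2)).
    by rewrite e subrr.
  by rewrite w'E; ring.
have w'lt : w' < w.
  have h4 : 4 * (w * w') <= 3 * w ^+ 2.
    rewrite ew; move: ha hb hc; rewrite !exprMn; clear; lra.
  rewrite -(ltr_pM2l w0) -(@ltr_pM2l _ 4) //; apply: (le_lt_trans h4).
  by have := exprn_gt0 2 w0; rewrite expr2; clear; lra.
have w'ge : 0 <= w' by rewrite -(pmulr_rge0 _ w0) ew !addr_ge0 ?sqr_ge0.
have [w'0|w'n] := eqVneq w' 0.
- exists a, b, c; move/esym/eqP: ew; rewrite w'0 mulr0.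
  rewrite !paddr_eq0 ?addr_ge0 ?sqr_ge0 // !sqrf_eq0 !subr_eq0.
  case/andP=> /andP [/eqP hx /eqP hy] /eqP hz.
  have : (n - (a ^+ 2 + b ^+ 2 + c ^+ 2)) * w ^+ 2 = 0.
    by rewrite mulrBl -e hx hy hz; ring.
  by move/eqP; rewrite mulf_eq0 sqrf_eq0 (gt_eqF w0) orbF subr_eq0 => /eqP.
- pose s := a ^+ 2 + b ^+ 2 + c ^+ 2 - n.
  have lw' : (`|w'| < k)%N by clear -w'lt w'ge lw w0; lia.
  have w'0 : 0 < w' by rewrite lt_def w'n.
  (* On the line from the integer point, the rational point has parameter 1. The product of the two
     roots is [s] over the squared distance, so the second intersection has parameter [s w / w']. *)
  apply: (IH (w' * a + s * (x - w * a)) (w' * b + s * (y - w * b))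
             (w' * c + s * (z - w * c)) w' lw' w'0).
  apply/eqP; rewrite -subr_eq0 (_ : _ - _ = s ^+ 2 * ((x - w * a) ^+ 2
    + (y - w * b) ^+ 2 + (z - w * c) ^+ 2 - w * w')); first by rewrite ew subrr mulr0.
  by rewrite /s w'E; ring.
Qed.

(** * Three squares *)

(** At odd primes [chi4] and [chi8] are the quadratic characters of -1 and 2. *)
Definition chi4 (n : nat) : int :=
  if (n %% 4 == 1)%N then 1 else if (n %% 4 == 3)%N then -1 else 0.

Definition chi8 (n : nat) : int :=
  if (n %% 8 \in [:: 1; 7])%N then 1 else if (n %% 8 \in [:: 3; 5])%N then -1 else 0.

Lemma chi4M m n : chi4 (m * n) = chi4 m * chi4 n.
Proof.
rewrite /chi4 -modnMm; have := ltn_pmod m (isT : 0 < 4)%N.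
have := ltn_pmod n (isT : 0 < 4)%N.
by case: (n %% 4)%N => [|[|[|[|//]]]] _; case: (m %% 4)%N => [|[|[|[|//]]]] _.
Qed.

Lemma chi8M m n : chi8 (m * n) = chi8 m * chi8 n.
Proof.
rewrite /chi8 -modnMm; have := ltn_pmod m (isT : 0 < 8)%N.
have := ltn_pmod n (isT : 0 < 8)%N.
by case: (n %% 8)%N => [|[|[|[|[|[|[|[|//]]]]]]]] _;
   case: (m %% 8)%N => [|[|[|[|[|[|[|[|//]]]]]]]] _.
Qed.

Lemma chi4_sign0 n : is_sign0 (chi4 n).
Proof. by rewrite /chi4; case: ifP => // _; case: ifP. Qed.

Lemma chi8_sign0 n : is_sign0 (chi8 n).
Proof. by rewrite /chi8; case: ifP => // _; case: ifP. Qed.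

Lemma chi4_eq0 n : (chi4 n == 0) = ~~ odd n.
Proof. by rewrite /chi4; case: ifP => [|h1]; [|case: ifP]; rewrite /=; lia. Qed.

Lemma chi8_eq0 n : (chi8 n == 0) = ~~ odd n.
Proof. by rewrite /chi8 !inE; case: ifP => [|h1]; [|case: ifP]; rewrite /=; lia. Qed.

Lemma sign0_sqr s : is_sign0 s -> s != 0 -> s * s = 1.
Proof. by rewrite /is_sign0 !inE => /or3P [] /eqP->. Qed.

Lemma sign0_cases s : is_sign0 s -> s != 0 -> s = 1 \/ s = -1.
Proof. by rewrite /is_sign0 !inE => /or3P [] /eqP->; [|left|right]. Qed.

Definition squarefree (m : nat) : Prop := forall p, prime p -> ~~ (p * p %| m)%N.

Lemma squarefree_gt0 m : squarefree m -> (0 < m)%N.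
Proof. by move/(_ 2%N isT); case: m. Qed.

Lemma squarefree_dvd d m : squarefree m -> (d %| m)%N -> squarefree d.
Proof. by move=> sf dm p pp; apply: contra (sf p pp) => /dvdn_trans; apply. Qed.

Lemma squarefree_coprime p k : prime p -> squarefree (p * k) -> coprime p k.
Proof.
move=> pp sf; rewrite prime_coprime //; apply: contra (sf p pp) => pk.
by rewrite dvdn_pmul2l ?prime_gt0.
Qed.

Lemma square_times_squarefree n : (0 < n)%N ->
  exists s m, [/\ (0 < s)%N, squarefree m & n = (s * s * m)%N].
Proof.
have [k] := ubnP n; elim: k n => // k IH n ltnk n0.
have [[p [pp /dvdnP [d e]]]|none] := pselect (exists p, prime p /\ (p * p %| n)%N).
  have p1 := prime_gt1 pp.
  have d0 : (0 < d)%N by move: n0; rewrite e; case: (d).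
  have [|s [m [s0 sf em]]] := IH d _ d0.
    rewrite -ltnS; apply: leq_trans ltnk; rewrite ltnS e ltn_Pmulr //.
    exact: (ltn_mul p1 p1).
  by exists (s * p)%N, m; split=> //; [rewrite muln_gt0 s0 ltnW | rewrite e em; ring].
exists 1%N, n; split=> //; last by rewrite !mul1n.
by move=> p pp; apply: contra_notN none => h; exists p.
Qed.

(** This takes the place of the Jacobi symbol: [legendre q m] is evaluated by comparing it with
    [chi4] or [chi4 * chi8] at the primes of [m]. *)
Lemma eq_mulfun_primes (f g : nat -> int) m :
  (forall a b, f (a * b)%N = f a * f b) -> (forall a b, g (a * b)%N = g a * g b) ->
  f 1%N = 1 -> g 1%N = 1 -> (0 < m)%N ->
  (forall p, prime p -> (p %| m)%N -> f p = g p) -> f m = g m.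
Proof.
move=> fM gM f1 g1; have [k] := ubnP m; elim: k m => // k IH m ltmk m0 h.
have [m1|m1] := leqP m 1; first by (have -> : m = 1%N by lia); rewrite f1 g1.
have pp := pdiv_prime m1; have pd := pdiv_dvd m; set p := pdiv m in pp pd.
move/dvdnP: pd => [d e]; have p1 := prime_gt1 pp.
have d0 : (0 < d)%N by move: m0; rewrite e; case: (d).
have dm : (d < m)%N by rewrite e ltn_Pmulr.
rewrite e fM gM; congr (_ * _).
  apply: IH => //; first by rewrite -ltnS; apply: leq_trans ltmk.
  by move=> r rr rd; apply: h => //; rewrite e dvdn_mulr.
by apply: h => //; rewrite e dvdn_mull.
Qed.

Lemma sqrt_mod_squarefree m t : squarefree m ->
  (forall p, prime p -> (p %| m)%N -> exists x, (p %| x * x + t)%N) ->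
  exists x, (m %| x * x + t)%N.
Proof.
have [k] := ubnP m; elim: k m => // k IH m ltmk sf h.
have m0 := squarefree_gt0 sf.
have [m1|m1] := leqP m 1; first by exists 0%N; (have -> : m = 1%N by lia); exact: dvd1n.
have pp := pdiv_prime m1; have pd := pdiv_dvd m; set p := pdiv m in pp pd.
have [y py] := h p pp pd.
move/dvdnP: pd => [d e]; have p1 := prime_gt1 pp.
have d0 : (0 < d)%N by move: m0; rewrite e; case: (d).
have dm : (d < m)%N by rewrite e ltn_Pmulr.
have cop : coprime p d by apply: squarefree_coprime; rewrite // mulnC -e.
have [||r rr rd|z dz] := IH d.
- by rewrite -ltnS; apply: leq_trans ltmk.
- by apply: squarefree_dvd sf _; rewrite e dvdn_mulr.
- by apply: h; rewrite // e dvdn_mulr.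
exists (chinese p d y z).
have lift c x w : (c %| w * w + t)%N -> x = w %[mod c] -> (c %| x * x + t)%N.
  move=> cw ex; rewrite /dvdn -modnDml -modnMm ex modnMm modnDml; exact: cw.
rewrite e mulnC Gauss_dvd //; apply/andP; split.
  by apply: lift py _; rewrite chinese_modl.
by apply: lift dz _; rewrite chinese_modr.
Qed.

Lemma modn_coprime a b c : a = b %[mod c] -> coprime a c = coprime b c.
Proof. by move=> e; rewrite -coprime_modl e coprime_modl. Qed.

Lemma chi4_mod8 n : chi4 (n %% 8) = chi4 n.
Proof. by rewrite /chi4 modn_dvdm. Qed.

Lemma chi8_mod8 n : chi8 (n %% 8) = chi8 n.
Proof. by rewrite /chi8 modn_mod. Qed.

Lemma exists_prime_with_residues (m : nat) (e4 e8 : int) (e : nat -> int) :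
  odd m -> squarefree m -> e4 = 1 \/ e4 = -1 -> e8 = 1 \/ e8 = -1 ->
  (forall p, prime p -> (p %| m)%N -> e p = 1 \/ e p = -1) ->
  exists q, [/\ prime q, chi4 q = e4, chi8 q = e8 &
                forall p, prime p -> (p %| m)%N -> legendre p q = e p].
Proof.
move=> om sf h4 h8 he; have m0 := squarefree_gt0 sf.
pose k := size (primes m); pose P (i : 'I_k) := nth 0%N (primes m) i.
have PP i : P i \in primes m by apply: mem_nth.
have Pp i : prime (P i) by have := PP i; rewrite mem_primes => /andP [].
have Pd i : (P i %| m)%N by have := PP i; rewrite mem_primes => /and3P [].
have Po i : odd (P i) by apply: dvdn_odd (Pd i) om.
have Pinj : injective P.
  by move=> i j /eqP; rewrite nth_uniq ?primes_uniq // => /eqP /val_inj.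
pose M := (8 * m)%N.
have cop8 : coprime 8 m by rewrite (@coprime_pexpl 3 2) // coprime2n.
pose base (i : option (option 'I_k)) (n : nat) : int :=
  match i with
  | None => chi4 n | Some None => chi8 n | Some (Some i) => legendre (P i) n
  end.
(* The restriction gives all the characters the same zeros, namely the integers not coprime to
   [M]. *)
pose chi i n := if coprime n M then base i n else 0.
pose eps (i : option (option 'I_k)) : int :=
  match i with None => e4 | Some None => e8 | Some (Some i) => e (P i) end.
have base0 i n : coprime n M -> base i n != 0.
  rewrite coprimeMr => /andP [c8 cm].
  have on : odd n by move: c8; rewrite coprime_sym (@coprime_pexpl 3 2) // coprime2n.
  case: i => [[i|]|] /=; rewrite ?chi4_eq0 ?chi8_eq0 ?on //.
  rewrite legendre_eq0 // -prime_coprime // coprime_sym.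
  exact: coprime_dvdr (Pd i) cm.
have baseM i a b : base i (a * b)%N = base i a * base i b.
  by case: i => [[i|]|] /=; rewrite ?chi4M ?chi8M ?legendreM.
have baseE i a b : a = b %[mod M] -> base i a = base i b.
  move=> eab; have e8' : a = b %[mod 8].
    by rewrite -(modn_dvdm a (dvdn_mulr m (dvdnn 8))) eab modn_dvdm ?dvdn_mulr.
  case: i => [[i|]|] /=.
  - have dP : (P i %| M)%N by apply: dvdn_mull.
    have eP : a = b %[mod P i] by rewrite -(modn_dvdm a dP) eab modn_dvdm.
    by rewrite -[LHS]legendre_mod // eP legendre_mod.
  - by rewrite -chi8_mod8 e8' chi8_mod8.
  - by rewrite -chi4_mod8 e8' chi4_mod8.
have [q pq hq] : exists2 q, prime q & forall i, chi i q = eps i.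
  apply: (@exists_prime_with_signs _ M).
  - by rewrite muln_gt0.
  - move=> i n; rewrite /chi (@modn_coprime _ n) ?modnDr //.
    by rewrite (baseE i (n + M)%N n) // modnDr.
  - move=> i a b; rewrite /chi coprimeMl baseM.
    by case: coprime; case: coprime; rewrite ?mulr0 ?mul0r.
  - by move=> i; rewrite /chi coprime1n; case: i => [[i|]|] //=; rewrite legendre1.
  - move=> i n; rewrite /chi; case: ifP => // _.
    by case: i => [[i|]|] /=; rewrite ?chi4_sign0 ?chi8_sign0 ?legendre_sign0.
  - by move=> i n; rewrite /chi; case: ifP => // c; apply/negbTE/base0.
  - have coprM a : coprime a 8 -> coprime a m -> coprime a M.
      by move=> c8 cm; rewrite coprimeMr c8.
    have leg1 (i : 'I_k) a d : (P i %| d)%N -> a = 1 %[mod d] -> legendre (P i) a = 1.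
      move=> pd ea; rewrite -(legendre_mod a) // -(modn_dvdm a pd) ea modn_dvdm //.
      by rewrite legendre_mod // legendre1.
    case=> [[i|]|].
    + have [b hb] := exists_legendreN1 (Pp i) (Po i).
      have /dvdnP [d dE] := Pd i.
      have copPd : coprime (P i) d by apply: squarefree_coprime; rewrite // mulnC -dE.
      have cop : coprime (P i) (8 * d).
        rewrite coprimeMr copPd andbT coprime_sym (@coprime_pexpl 3 2) //.
        by rewrite coprime2n.
      (* Independence at [P i]: a nonresidue there that is 1 modulo 8 and modulo the other
         primes. *)
      pose a := chinese (P i) (8 * d) b 1.
      have a1 : a = b %[mod P i] by rewrite chinese_modl.
      have a2 : a = 1 %[mod 8 * d] by rewrite chinese_modr.
      have l : legendre (P i) a = -1 by rewrite -(legendre_mod a) // a1 legendre_mod.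
      have a8 : a = 1 %[mod 8].
        by rewrite -(modn_dvdm a (dvdn_mulr d (dvdnn 8))) a2 modn_dvdm ?dvdn_mulr.
      have aM : coprime a M.
        apply: coprM; first by rewrite (modn_coprime a8).
        rewrite dE coprimeMr; apply/andP; split.
          have ad : a = 1 %[mod d].
            by rewrite -(modn_dvdm a (dvdn_mull 8 (dvdnn d))) a2 modn_dvdm ?dvdn_mull.
          by rewrite (modn_coprime ad) coprime1n.
        by rewrite coprime_sym prime_coprime // -legendre_eq0 // l.
      exists a; rewrite /chi aM //.
      case=> [[j|]|] ne /=.
      * apply: (leg1 j a (8 * d)%N) => //.
        have : (P j %| d * P i)%N by rewrite -dE.
        rewrite Euclid_dvdM // => /orP [pd|]; first by rewrite dvdn_mull.
        rewrite dvdn_prime2 // => /eqP /Pinj eij; by rewrite eij eqxx in ne.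
      * by rewrite -chi8_mod8 a8.
      * by rewrite -chi4_mod8 a8.
    (* The class 5 modulo 8 changes the sign of [chi8] only; the class 7 below changes that of
       [chi4] only. *)
    + pose a := chinese 8 m 5 1.
      have a8 : a = 5 %[mod 8] by rewrite chinese_modl.
      have am : a = 1 %[mod m] by rewrite chinese_modr.
      have aM : coprime a M.
        by apply: coprM; rewrite ?(modn_coprime a8) // (modn_coprime am) coprime1n.
      exists a; rewrite /chi aM /=; first by rewrite -chi8_mod8 a8.
      case=> [[j|]|] //= _; first exact: (leg1 j a m).
      by rewrite -chi4_mod8 a8.
    + pose a := chinese 8 m 7 1.
      have a8 : a = 7 %[mod 8] by rewrite chinese_modl.
      have am : a = 1 %[mod m] by rewrite chinese_modr.
      have aM : coprime a M.
        by apply: coprM; rewrite ?(modn_coprime a8) // (modn_coprime am) coprime1n.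
      exists a; rewrite /chi aM /=; first by rewrite -chi4_mod8 a8.
      case=> [[j|]|] //= _; first exact: (leg1 j a m).
      by rewrite -chi8_mod8 a8.
  - by case=> [[i|]|] //=; apply: he.
have qM : coprime q M.
  have := hq None; rewrite /chi; case: ifP => // _ /= e40.
  by case: h4; rewrite -e40.
exists q; split=> //.
- by have := hq None; rewrite /chi qM.
- by have := hq (Some None); rewrite /chi qM.
- move=> p pp pm; have pin : p \in primes m by rewrite mem_primes pp m0.
  have ik : (index p (primes m) < k)%N by rewrite index_mem.
  have := hq (Some (Some (Ordinal ik))); rewrite /chi qM /=.
  by rewrite /P /= nth_index.
Qed.

Lemma legendre_neg_square p t : prime p -> odd p -> legendre p t = chi4 p ->
  exists x, (p %| x * x + t)%N.
Proof.
move=> pp op ht; have p0 := prime_gt0 pp.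
have c4 : chi4 p = legendre p p.-1.
  by rewrite legendre_predp // /chi4; case: ifP => // h1; case: ifP => // h2; lia.
have : legendre p (p.-1 * t) = 1.
  rewrite legendreM // -c4 ht sign0_sqr ?chi4_sign0 //.
  by rewrite chi4_eq0 op.
move/(legendre_eq1_square pp op) => [x hx]; exists x.
by rewrite /dvdn -modnDml hx modnDml -mulSnr prednK // modnMr.
Qed.

Lemma legendre_two_chi8 p : prime p -> odd p -> legendre p 2 = chi8 p.
Proof.
move=> pp op; rewrite legendre_two // /chi8 !inE.
by case: ifP => // h1; case: ifP => // h2; lia.
Qed.

Lemma legendre_flip p q : prime p -> prime q -> odd p -> (q %% 4 = 1)%N ->
  p != q -> legendre q p = legendre p q.
Proof.
move=> pp pq op q4 npq; have oq : odd q by lia.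
have := quadratic_reciprocity pp pq op oq npq.
rewrite -signr_odd oddM (_ : odd q./2 = false) ?andbF ?expr0; last by lia.
have npdq : legendre p q != 0 by rewrite legendre_eq0 // dvdn_prime2.
have nqdp : legendre q p != 0 by rewrite legendre_eq0 // dvdn_prime2 // eq_sym.
by have [->|->] := sign0_cases (legendre_sign0 p q) npdq;
   have [->|->] := sign0_cases (legendre_sign0 q p) nqdp.
Qed.

(** Since [q] divides [t] exactly once, [t] is not a square and the ternary equation is solvable.
    Replacing [t] by [u ^+ 2 + v ^+ 2] gives a rational point for Aubry's descent. *)
Lemma three_squares_of_prime (m t q : nat) (a b u v : int) :
  (0 < m)%N -> prime q -> logn q t = 1%N -> coprime m t ->
  (m%:Z %| a ^+ 2 + t%:Z)%Z -> (t%:Z %| b ^+ 2 - m%:Z)%Z ->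
  t%:Z = u ^+ 2 + v ^+ 2 -> sum_of_three_squares m%:Z.
Proof.
move=> m0 pq lt cop da db te.
have nsq := @not_square_of_odd_logn q t; rewrite lt in nsq.
have [x [y [w [w0 e]]]] := legendre_ternary m0 (nsq isT) da db cop.
apply: (@aubry m%:Z x (u * y) (v * y) w w0).
by rewrite -e te; ring.
Qed.

Lemma two_dvd_odd_sqrB (c m : nat) : odd c -> odd m -> (2 %| c%:Z ^+ 2 - m%:Z)%Z.
Proof.
move=> oc om; have [i ->] : exists i, c%:Z = 2 * i + 1 by exists c./2%:Z; lia.
have [j ->] : exists j, m%:Z = 2 * j + 1 by exists m./2%:Z; lia.
by apply/dvdzP; exists (2 * i ^+ 2 + 2 * i - j); ring.
Qed.

Lemma three_squares_squarefree m : squarefree m -> (m %% 8 != 7)%N ->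
  sum_of_three_squares m%:Z.
Proof.
move=> sf m7; have m0 := squarefree_gt0 sf.
have two_sq q : prime q -> (q %% 4 = 1)%N -> exists x y : int, q%:Z = x ^+ 2 + y ^+ 2.
  move=> pq q4; have [|x xq] := @legendre_neg_square q 1 pq ltac:(lia).
    by rewrite legendre1 /chi4 q4.
  apply: (@two_squares_of_sqr_mod q x%:Z pq).
  by rewrite -[x%:Z ^+ 2 + 1]/((x * x + 1)%N%:Z) dvdzE.
have to_int (d x t : nat) : (d %| x * x + t)%N -> (d%:Z %| x%:Z ^+ 2 + t%:Z)%Z.
  by move=> h; rewrite -[_ ^+ 2 + _]/((x * x + t)%N%:Z) dvdzE.
have root_mod (q : nat) : prime q -> odd q -> legendre q m = 1 ->
    exists b : nat, (q%:Z %| b%:Z ^+ 2 - m%:Z)%Z.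
  move=> pq oq /(legendre_eq1_square pq oq) [b hb]; exists b.
  by rewrite -eqz_mod_dvd -[b%:Z ^+ 2]/((b * b)%N%:Z) !modz_nat hb.
have sqfree4 : (m %% 4 != 0)%N by apply: (sf 2%N isT).
have chi4_pm (p : nat) : odd p -> chi4 p = 1 \/ chi4 p = -1.
  by move=> op; apply: sign0_cases; rewrite ?chi4_sign0 // chi4_eq0 op.
have chi8_pm (p : nat) : odd p -> chi8 p = 1 \/ chi8 p = -1.
  by move=> op; apply: sign0_cases; rewrite ?chi8_sign0 // chi8_eq0 op.
have chi4_1 (q : nat) : chi4 q = 1 -> (q %% 4 = 1)%N.
  by rewrite /chi4; case: eqP => // _; case: ifP.
have [om|em] := boolP (odd m).
- have podd (p : nat) : (p %| m)%N -> odd p by move=> pm; apply: dvdn_odd om.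
  have [m4|m4] := eqVneq (m %% 4)%N 1%N.
  + have [p pp pm|q [pq q4 _ hq]] := exists_prime_with_residues om sf
      (or_introl (erefl 1)) (or_introl (erefl 1)) (e := chi4).
      by apply: chi4_pm; apply: podd.
    have {}q4 := chi4_1 q q4.
    have oq : odd q by lia.
    have nq (p : nat) : prime p -> (p %| m)%N -> p != q.
      move=> pp pm; apply/eqP => epq; have := hq p pp pm.
      move/eqP; rewrite epq; have /eqP -> : legendre q q == 0 by rewrite legendre_eq0.
      by rewrite eq_sym chi4_eq0 oq.
    have lm : legendre q m = 1.
      rewrite (@eq_mulfun_primes (legendre q) chi4) //.
      * by rewrite /chi4 m4.
      * by move=> x y; apply: legendreM.
      * exact: chi4M.
      * exact: legendre1.
      * by move=> p pp pm; rewrite legendre_flip ?hq ?nq ?podd.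
    have [p pp pm|a ha] := @sqrt_mod_squarefree m q sf.
      by apply: legendre_neg_square; rewrite ?hq ?podd.
    have [b hb] := root_mod q pq oq lm.
    have [u [v huv]] := two_sq q pq q4.
    apply: (three_squares_of_prime m0 pq _ _ (to_int _ _ _ ha) hb huv).
    * by rewrite logn_prime ?eqxx.
    * rewrite coprime_sym prime_coprime //; apply/negP => qm.
      by have := nq q pq qm; rewrite eqxx.
  (* Here [t = 2 q], so the prescribed sign at [p] gains the factor [chi8 p], the character of 2. *)
  + have m3 : (m %% 8 = 3)%N by lia.
    have [p pp pm|q [pq q4 q8 hq]] := exists_prime_with_residues om sf
      (or_introl (erefl 1)) (or_introl (erefl 1)) (e := fun p => chi4 p * chi8 p).
      by have [->|->] := chi4_pm p (podd p pm); have [->|->] := chi8_pm p (podd p pm);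
        [left|right|right|left].
    have {}q4 := chi4_1 q q4.
    have oq : odd q by lia.
    have nq (p : nat) : prime p -> (p %| m)%N -> p != q.
      move=> pp pm; apply/eqP => epq; have := hq p pp pm.
      move/eqP; rewrite epq; have /eqP -> : legendre q q == 0 by rewrite legendre_eq0.
      by rewrite eq_sym mulf_eq0 chi4_eq0 chi8_eq0 oq.
    have lm : legendre q m = 1.
      rewrite (@eq_mulfun_primes (legendre q) (fun n => chi4 n * chi8 n)) //.
      * by rewrite /chi8 m3 /chi4 (_ : m %% 4 = 3)%N; [|lia].
      * by move=> x y; apply: legendreM.
      * by move=> x y; rewrite chi4M chi8M; ring.
      * exact: legendre1.
      * by move=> p pp pm; rewrite legendre_flip ?hq ?nq ?podd.
    have [p pp pm|a ha] := @sqrt_mod_squarefree m (2 * q) sf.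
      have op := podd p pm.
      apply: legendre_neg_square => //; rewrite legendreM // hq // legendre_two_chi8 //.
      by rewrite mulrCA sign0_sqr ?mulr1 ?chi8_sign0 // chi8_eq0 op.
    have [b hb] := root_mod q pq oq lm.
    have [b' hb'] : exists b' : int, ((2 * q)%N%:Z %| b' ^+ 2 - m%:Z)%Z.
      have cop2 : coprimez 2 q%:Z by rewrite coprimezE coprime2n.
      (* Adding the odd number [q] corrects the parity, so that the square is congruent to [m]
         modulo 2 as well as modulo [q]. *)
      exists (if odd b then b else (b + q)%N)%:Z.
      rewrite PoszM Gauss_dvdz //; apply/andP; split.
        by apply: two_dvd_odd_sqrB => //; case: ifP => // ob; rewrite oddD ob oq.
      case: ifP => // _; rewrite PoszD.
      have -> : (b%:Z + q%:Z) ^+ 2 - m%:Z =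
        (b%:Z ^+ 2 - m%:Z) + (2 * b%:Z + q%:Z) * q%:Z by ring.
      by rewrite rpredD // dvdz_mull.
    have [u [v huv]] := two_sq q pq q4.
    have q2 : q != 2%N by apply: contraTneq oq => ->.
    apply: (@three_squares_of_prime m (2 * q) q a%:Z b' (u + v) (u - v)) => //.
    * by rewrite lognM ?prime_gt0 // !logn_prime // eqxx (negPf q2).
    * rewrite coprimeMr coprimen2 om /= coprime_sym prime_coprime //; apply/negP => qm.
      by have := nq q pq qm; rewrite eqxx.
    * by rewrite PoszM huv; ring.
- have [m' em'] : exists m', m = (2 * m')%N by exists m./2; lia.
  have om' : odd m' by lia.
  have sf' : squarefree m' by apply: squarefree_dvd sf _; rewrite em' dvdn_mull.
  have podd (p : nat) : (p %| m')%N -> odd p by move=> pm; apply: dvdn_odd om'.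
  (* Choosing [chi8 q = chi4 m'] makes the characters of 2 and of [m'] modulo [q] cancel. *)
  have [p pp pm|q [pq q4 q8 hq]] := exists_prime_with_residues om' sf'
      (or_introl (erefl 1)) (chi4_pm m' om') (e := chi4).
    by apply: chi4_pm; apply: podd.
  have {}q4 := chi4_1 q q4.
  have oq : odd q by lia.
  have nq (p : nat) : prime p -> (p %| m')%N -> p != q.
    move=> pp pm; apply/eqP => epq; have := hq p pp pm.
    move/eqP; rewrite epq; have /eqP -> : legendre q q == 0 by rewrite legendre_eq0.
    by rewrite eq_sym chi4_eq0 oq.
  have lm : legendre q m = 1.
    rewrite em' legendreM // legendre_two_chi8 //.
    rewrite (@eq_mulfun_primes (legendre q) chi4 m') //.
    * by rewrite q8 sign0_sqr ?chi4_sign0 // chi4_eq0 om'.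
    * by move=> x y; apply: legendreM.
    * exact: chi4M.
    * exact: legendre1.
    * exact: squarefree_gt0.
    * by move=> p pp pm; rewrite legendre_flip ?hq ?nq ?podd.
  have [p pp pm|a ha] := @sqrt_mod_squarefree m q sf.
    move: pm; rewrite em' Euclid_dvdM // => /orP [p2|pm].
      by move: p2; rewrite dvdn_prime2 // => /eqP->; exists q; rewrite dvdn2; lia.
    by apply: legendre_neg_square; rewrite ?hq ?podd.
  have [b hb] := root_mod q pq oq lm.
  have [u [v huv]] := two_sq q pq q4.
  apply: (three_squares_of_prime m0 pq _ _ (to_int _ _ _ ha) hb huv).
  * by rewrite logn_prime ?eqxx.
  * rewrite em' coprimeMl coprime2n oq /= coprime_sym prime_coprime //; apply/negP => qm.
    by have := nq q pq qm; rewrite eqxx.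
Qed.

(** * The square class of factorials *)

(** For positive [n] this is the class modulo squares in the 2-adic numbers: a 2-adic unit is a
    square exactly when it is 1 modulo 8. *)
Definition square_class2 (n : nat) : bool * nat :=
  (odd (logn 2 n), (n`_2^' %% 8)%N).

Definition mulc (c d : bool * nat) : bool * nat :=
  (c.1 (+) d.1, (c.2 * d.2) %% 8)%N.

Lemma square_class2M m n : (0 < m)%N -> (0 < n)%N ->
  square_class2 (m * n) = mulc (square_class2 m) (square_class2 n).
Proof.
by move=> m0 n0; rewrite /square_class2 /mulc /= lognM // oddD partnM // modnMm.
Qed.

Lemma square_class2_odd n : odd n -> square_class2 n = (false, (n %% 8)%N).
Proof.
move=> on; rewrite /square_class2 lognE dvdn2 on andbF /=.
by rewrite part_pnat_id // p'natE // dvdn2 on.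
Qed.

Lemma square_class2_exp2 n : square_class2 (2 ^ n) = (odd n, 1%N).
Proof.
rewrite /square_class2 pfactorK //; congr (_, _).
by rewrite part_p'nat // pnatNK pnatX.
Qed.

Lemma odd_sqr_mod8 n : odd n -> (n * n %% 8 = 1)%N.
Proof.
move=> on; rewrite -modnMm; have : odd (n %% 8) by rewrite -[8%N]/(4 * 2)%N; lia.
by have := ltn_pmod n (isT : 0 < 8)%N; case: (n %% 8)%N => [|[|[|[|[|[|[|[|]]]]]]]].
Qed.

Lemma square_class2_sqr n : (0 < n)%N -> square_class2 (n * n) = (false, 1%N).
Proof.
move=> n0; rewrite square_class2M // /mulc addbb /= modnMm odd_sqr_mod8 //.
rewrite -[odd _]negbK -dvdn2 -p'natE // part_pnat //.
Qed.

Lemma int_even_or_sqr1 (x : int) :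
  (exists y, x = 2 * y) \/ (exists k, x ^+ 2 = 8 * k + 1).
Proof.
have [[y ->]|[y ->]] : (exists y, x = 2 * y) \/ (exists y, x = 2 * y + 1).
- have : (x %% 2)%Z = 0 \/ (x %% 2)%Z = 1 by lia.
  by move=> [h|h]; [left|right]; exists (x %/ 2)%Z; lia.
- by left; exists y.
- right; have [[z ->]|[z ->]] : (exists z, y = 2 * z) \/ (exists z, y = 2 * z + 1).
    have : (y %% 2)%Z = 0 \/ (y %% 2)%Z = 1 by lia.
    by move=> [h|h]; [left|right]; exists (y %/ 2)%Z; lia.
  + by exists (2 * z ^+ 2 + z); ring.
  + by exists (2 * z ^+ 2 + 3 * z + 1); ring.
Qed.

Lemma int_sqr_even_mod8 (y : int) :
  exists k, (2 * y) ^+ 2 = 8 * k \/ (2 * y) ^+ 2 = 8 * k + 4.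
Proof.
have [[z ->]|[k e]] := int_even_or_sqr1 y.
  by exists (2 * z ^+ 2); left; ring.
by exists (4 * k); right; rewrite exprMn e; ring.
Qed.

Lemma not_three_squares_mod8 (n : int) (b : int) :
  n = 8 * b + 7 -> ~ sum_of_three_squares n.
Proof.
move=> -> [x [y [z e]]].
have sq (w : int) :
    exists k, [\/ w ^+ 2 = 8 * k, w ^+ 2 = 8 * k + 4 | w ^+ 2 = 8 * k + 1].
  have [[v ->]|[k ->]] := int_even_or_sqr1 w; last by exists k; constructor 3.
  by have [k [->|->]] := int_sqr_even_mod8 v; exists k; [constructor 1|constructor 2].
move: e; have [k1 h1] := sq x; have [k2 h2] := sq y; have [k3 h3] := sq z.
by case: h1 => ->; case: h2 => ->; case: h3 => ->; lia.
Qed.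

(** Odd squares are 1 modulo 8, so a sum of three squares divisible by 4 has only even terms, which
    can all be halved. *)
Lemma three_squares_div4 (n : int) :
  sum_of_three_squares (4 * n) -> sum_of_three_squares n.
Proof.
move=> [x [y [z e]]].
have sq (w : int) :
    exists k, (exists v, w ^+ 2 = 4 * k /\ k = v ^+ 2) \/ w ^+ 2 = 8 * k + 1.
  have [[v ->]|[k ->]] := int_even_or_sqr1 w; last by exists k; right.
  by exists (v ^+ 2); left; exists v; split=> //; ring.
have [k1 h1] := sq x; have [k2 h2] := sq y; have [k3 h3] := sq z.
case: h1 => [[v1 [e1 f1]]|e1]; case: h2 => [[v2 [e2 f2]]|e2];
  case: h3 => [[v3 [e3 f3]]|e3]; rewrite e1 e2 e3 in e; try by exfalso; lia.
by exists v1, v2, v3; rewrite -f1 -f2 -f3; lia.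
Qed.

(** The class [(false, 7)] means [n = 4^a (8 b + 7)], which is excluded by dividing by 4 and then
    reading modulo 8. Otherwise the squarefree part has the same class as [n], hence is not 7 modulo
    8. *)
Lemma three_squares_iff n : (0 < n)%N ->
  sum_of_three_squares n%:Z <-> square_class2 n != (false, 7%N).
Proof.
move=> n0; split.
- move=> s3; apply/negP => /eqP [ev o7].
  have nE : (2 ^ logn 2 n * n`_2^')%N = n by rewrite -p_part partnC.
  have [a ea] : exists a, logn 2 n = (2 * a)%N by exists (logn 2 n)./2; lia.
  have [b eb] : exists b, (n`_2^')%N%:Z = 8 * b + 7.
    by exists ((n`_2^') %/ 8)%N%:Z; lia.
  have {}nE : n%:Z = 4 ^+ a * (8 * b + 7).
    by rewrite -nE ea PoszM -eb expnM -[(2 ^ 2)%N]/4%N -natz natrX.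
  move: s3; rewrite nE; elim: (a) => [|k IH].
    by rewrite expr0 mul1r; apply: not_three_squares_mod8.
  by rewrite exprS -mulrA => /three_squares_div4.
- have [s [m [s0 sf ->]]] := square_times_squarefree n0.
  have m0 := squarefree_gt0 sf.
  rewrite square_class2M ?muln_gt0 ?s0 // square_class2_sqr //.
  move=> nb; have m7 : (m %% 8 != 7)%N.
    apply: contra nb => /eqP m7; have om : odd m by lia.
    by rewrite square_class2_odd // m7.
  have [x [y [z e]]] := three_squares_squarefree sf m7.
  by exists (s%:Z * x), (s%:Z * y), (s%:Z * z); rewrite PoszM e PoszM; ring.
Qed.

(** * Factorial classes read along binary digits *)

Definition fact_class (n : nat) : bool * nat := square_class2 n`!.

Lemma double_fact n : ((2 * n)`! = 2 ^ n * n`! * \prod_(i < n) (2 * i + 1))%N.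
Proof.
elim: n => [|n IH]; first by rewrite big_ord0.
have -> : (2 * n.+1 = (2 * n).+2)%N by lia.
by rewrite 2!factS IH big_ord_recr /= expnS factS; ring.
Qed.

(** The product has period 4 because [1 * 3 * 5 * 7 = 105] is 1 modulo 8. *)
Lemma prod_odds_mod8 n :
  (\prod_(i < n) (2 * i + 1) %% 8 = nth 0 [:: 1; 1; 3; 7] (n %% 4))%N.
Proof.
elim: n => [|n IH]; first by rewrite big_ord0.
rewrite big_ord_recr /= -modnMm IH.
have -> : ((2 * n + 1) %% 8 = 2 * (n %% 4) + 1)%N by lia.
have -> : (n.+1 %% 4 = (n %% 4).+1 %% 4)%N by lia.
by have := ltn_pmod n (isT : 0 < 4)%N; case: (n %% 4)%N => [|[|[|[|]]]].
Qed.

Definition double_class (r : nat) (c : bool * nat) : bool * nat :=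
  mulc c (odd r, nth 0 [:: 1; 1; 3; 7] r)%N.

Definition double1_class (r : nat) (c : bool * nat) : bool * nat :=
  mulc (double_class r c) (false, 2 * r + 1)%N.

Lemma mulcC c d : mulc c d = mulc d c.
Proof. by rewrite /mulc addbC mulnC. Qed.

Lemma fact_class_double n :
  fact_class (2 * n) = double_class (n %% 4) (fact_class n).
Proof.
rewrite /fact_class double_fact /double_class.
have oD : odd (\prod_(i < n) (2 * i + 1)).
  by elim/big_rec: _ => // i x _ ox; rewrite oddM ox; lia.
have D0 : (0 < \prod_(i < n) (2 * i + 1))%N by apply: odd_gt0.
rewrite !square_class2M ?muln_gt0 ?expn_gt0 ?fact_gt0 // square_class2_exp2.
rewrite (square_class2_odd oD) prod_odds_mod8 /mulc /=.
have -> : odd (n %% 4) = odd n by lia.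
congr (_, _); first by rewrite addbF addbC.
by rewrite mul1n modnMml.
Qed.

Lemma fact_class_double1 n :
  fact_class (2 * n + 1) = double1_class (n %% 4) (fact_class n).
Proof.
rewrite addn1 /fact_class factS square_class2M ?fact_gt0 //.
rewrite mulcC -/(fact_class _) fact_class_double square_class2_odd; last by lia.
by rewrite /double1_class; congr (mulc _ (_, _)); lia.
Qed.

(** The class at [n + 1] is kept because a window covers the blocks of both [n] and [n + 1]. The
    state still follows the digits: the successor of [2 n + 1] is [2 (n + 1)], and that of [2 n]
    depends on [n] alone. *)
Definition fact_state (n : nat) := ((n %% 4)%N, fact_class n, fact_class n.+1).

Definition state_step (b : bool) (s : nat * (bool * nat) * (bool * nat)) :=
  let: (r, c, c') := s in
  if b then ((2 * r + 1) %% 4, double1_class r c, double_class ((r + 1) %% 4) c')%N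
  else ((2 * r) %% 4, double_class r c, double1_class r c)%N.

Lemma fact_state_step (b : bool) n :
  fact_state (2 * n + b) = state_step b (fact_state n).
Proof.
case: b; rewrite /fact_state /state_step.
- have -> : ((2 * n + true).+1 = 2 * n.+1)%N by lia.
  have -> : (2 * n + true = 2 * n + 1)%N by [].
  rewrite fact_class_double1 fact_class_double.
  by congr (_, _, double_class _ _); lia.
- have -> : ((2 * n + false).+1 = 2 * n + 1)%N by lia.
  have -> : (2 * n + false = 2 * n)%N by lia.
  rewrite fact_class_double1 fact_class_double.
  by congr (_, _, _); lia.
Qed.

Definition initial_state : nat * (bool * nat) * (bool * nat) :=
  (0, (false, 1), (false, 1))%N.

Lemma fact_state0 : fact_state 0 = initial_state.
Proof.
by rewrite /fact_state /fact_class (@square_class2_odd 0`!) // (@square_class2_odd 1`!).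
Qed.

(** Sixteen rounds are enough to close the list under both steps; [fact_state_reachable] checks this
    closure by computation. *)
Definition reachable_states := Eval vm_compute in
  iter 16 (fun l => undup (l ++ map (state_step false) l ++ map (state_step true) l))
    [:: initial_state].

Lemma fact_state_reachable n : fact_state n \in reachable_states.
Proof.
have h0 : initial_state \in reachable_states by vm_compute.
have closed : all (fun s => (state_step false s \in reachable_states) &&
    (state_step true s \in reachable_states)) reachable_states by vm_compute.
have [k] := ubnP n; elim: k n => // k IH n ltnk.
have [->|n0] := posnP n; first by rewrite fact_state0.
have e : n = (2 * n./2 + odd n)%N by lia.
have /(allP closed) /andP [hf ht] : fact_state n./2 \in reachable_states.
  by apply: IH; lia.
by rewrite e fact_state_step; case: odd.
Qed.

(** Evaluates a state from the binary digits, without any factorial; [k] is fuel bounding their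
    number. *)
Fixpoint fact_state_compute (k n : nat) :=
  if k is k'.+1 then
    if n == 0%N then initial_state
    else state_step (odd n) (fact_state_compute k' n./2)
  else initial_state.

Lemma fact_state_computeE k n : (n < 2 ^ k)%N ->
  fact_state_compute k n = fact_state n.
Proof.
elim: k n => [|k IH] n /= lt.
  have -> : n = 0%N by move: lt; rewrite expn0; lia.
  by rewrite fact_state0.
case: eqP => [->|_]; first by rewrite fact_state0.
rewrite IH; last by move: lt; rewrite expnS; lia.
by rewrite -fact_state_step; congr fact_state; lia.
Qed.

(** * Reading the gaps off finitely many windows *)

Fixpoint class_block (k r : nat) (c : bool * nat) : seq (bool * nat) :=
  if k is k'.+1 then
    class_block k' ((2 * r) %% 4)%N (double_class r c) ++
    class_block k' ((2 * r + 1) %% 4)%N (double1_class r c)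
  else [:: c].

Lemma class_blockE k n :
  class_block k (n %% 4) (fact_class n) =
  [seq fact_class i | i <- iota (2 ^ k * n) (2 ^ k)].
Proof.
elim: k n => [|k IH] n /=; first by rewrite expn0 mul1n.
rewrite -fact_class_double -fact_class_double1.
have -> : ((2 * (n %% 4)) %% 4 = (2 * n) %% 4)%N by lia.
have -> : ((2 * (n %% 4) + 1) %% 4 = (2 * n + 1) %% 4)%N by lia.
rewrite !IH -map_cat; congr map.
have -> : (2 ^ k.+1 = 2 ^ k + 2 ^ k)%N by rewrite expnS mul2n addnn.
by rewrite iotaD; congr (iota _ _ ++ iota _ _); ring.
Qed.

Definition window (s : nat * (bool * nat) * (bool * nat)) : seq (bool * nat) :=
  let: (r, c, c') := s in class_block 6 r c ++ class_block 6 ((r + 1) %% 4) c'.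

Lemma windowE n :
  window (fact_state n) = [seq fact_class i | i <- iota (64 * n) 128].
Proof.
rewrite /window /fact_state; have -> : ((n %% 4 + 1) %% 4 = n.+1 %% 4)%N by lia.
rewrite !class_blockE -map_cat -[(2 ^ 6)%N]/64%N; congr map.
by rewrite -[128%N]/(64 + 64)%N iotaD; congr (_ ++ iota _ _); lia.
Qed.

(** If no later entry satisfies [P], [find] returns the length of the rest, so in a window of 128
    entries [i + next_in P w i] is exactly 128 and fails the tests against 128 below. *)
Definition next_in (P : pred (bool * nat)) (w : seq (bool * nat)) (i : nat) : nat :=
  (find P (drop i.+1 w)).+1.

Definition gaps_within (P : pred (bool * nat)) (L : seq nat) (w : seq (bool * nat)) :=
  all (fun i => P (nth (false, 0%N) w i) ==>
     ((i + next_in P w i < 128)%N && (next_in P w i \in L))) (iota 0 64).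

Definition gap_occurs (P : pred (bool * nat)) (g : nat) (w : seq (bool * nat)) :=
  has (fun i => [&& P (nth (false, 0%N) w i), (i + g < 128)%N & next_in P w i == g])
    (iota 0 64).

Lemma next_inP (P : pred (bool * nat)) n i : (i < 64)%N ->
  (i + next_in P (window (fact_state n)) i < 128)%N ->
  let g := next_in P (window (fact_state n)) i in
  P (fact_class (64 * n + i + g)) /\
  (forall j, (64 * n + i < j < 64 * n + i + g)%N -> ~~ P (fact_class j)).
Proof.
move=> i64 lt g; have w := windowE n.
have nthw j : (j < 128)%N ->
    nth (false, 0%N) (window (fact_state n)) j = fact_class (64 * n + j).
  by move=> j128; rewrite w (nth_map 0%N) ?size_iota // nth_iota.
have szd : size (drop i.+1 (window (fact_state n))) = (128 - i.+1)%N.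
  by rewrite size_drop w size_map size_iota.
rewrite /g /next_in in lt *; set d := find _ _ in lt *; split.
- have hP : has P (drop i.+1 (window (fact_state n))).
    by rewrite has_find szd -/d; lia.
  have := nth_find (false, 0%N) hP; rewrite -/d nth_drop nthw; last by lia.
  by congr (P (fact_class _)); lia.
- move=> j /andP [j1 j2].
  have jd : (j - (64 * n + i.+1) < d)%N by lia.
  have := before_find (false, 0%N) jd; rewrite nth_drop nthw; last by lia.
  have -> : (64 * n + (i.+1 + (j - (64 * n + i.+1))) = j)%N by lia.
  by move=> ->.
Qed.

(** A gap starting at [n] is seen at position [n %% 64] of the window of [n %/ 64], and all possible
    windows are checked. Conversely a pair [(g, n)] of [wit] certifies a gap [g] starting in the
    block of 64 integers from [64 n]; [0 < n] keeps these integers positive. *)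
Lemma gap_sizes_fact (P : pred (bool * nat)) (Q : nat -> Prop) (L : seq nat)
    (wit : seq (nat * nat)) :
  (forall n, (0 < n)%N -> Q n <-> P (fact_class n)) ->
  all (fun s => gaps_within P L (window s)) reachable_states ->
  all (fun gn => [&& (0 < gn.2 < 2 ^ 12)%N, (0 < gn.1)%N &
        gap_occurs P gn.1 (window (fact_state_compute 12 gn.2))]) wit ->
  map fst wit = L ->
  gap_sizes [set n%:Z | n in [set n : nat | (0 < n)%N /\ Q n]]%classic =
  [set g : nat | g \in L]%classic.
Proof.
move=> hQ hall hwit eL; rewrite -{}eL in hall *; apply/seteqP; split=> g /=.
- move=> [g0 [x [y [[n [n0 Qn] <-] [m [m0 Qm] <-] ltnm none e]]]].
  have lt : (n < m)%N by lia.
  have Pn : P (fact_class n) by apply/hQ.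
  have Pm : P (fact_class m) by apply/hQ.
  have nE : n = (64 * (n %/ 64) + n %% 64)%N by lia.
  have i64 : (n %% 64 < 64)%N by rewrite ltn_mod.
  have /(allP hall) /allP := fact_state_reachable (n %/ 64).
  move=> /(_ (n %% 64)%N); rewrite mem_iota i64 => /(_ isT).
  have -> : nth (false, 0%N) (window (fact_state (n %/ 64))) (n %% 64) = fact_class n.
    rewrite windowE (nth_map 0%N) ?size_iota; last by lia.
    by rewrite nth_iota -?nE //; lia.
  rewrite Pn implyTb => /andP [lt128 gL].
  have [Pg before] := next_inP i64 lt128; rewrite -nE in Pg before.
  have d0 : (0 < next_in P (window (fact_state (n %/ 64))) (n %% 64))%N by [].
  move: (next_in _ _ _) d0 gL Pg before {lt128 i64 nE} => d d0 gL Pg before.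
  (* The end [m] cannot precede [n + d], as no integer between [n] and [n + d] satisfies [P]; nor
     can it exceed [n + d], which would then lie inside the gap. *)
  suff -> : g = d by [].
  have [ltmd|ltdm|emd] := ltngtP m (n + d)%N.
  + by have := before m; rewrite lt ltmd Pm => /(_ isT).
  + case: (none (n + d)%N%:Z); last by lia.
    by exists (n + d)%N => //; split; [lia | apply/hQ => //; lia].
  + by lia.
- case/mapP => -[h n] hin eg; have {eg} -> : g = h := eg.
  have : [&& (0 < n < 2 ^ 12)%N, (0 < h)%N &
      gap_occurs P h (window (fact_state_compute 12 n))] := allP hwit _ hin.
  case/and3P=> /andP [n0 n12] h0; rewrite fact_state_computeE // => /hasP [i].
  rewrite mem_iota => i64 /and3P [Pi i128 /eqP eh].
  have [|Pg before] := @next_inP P n i i64; first by rewrite eh.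
  rewrite eh in Pg before.
  have {}Pi : P (fact_class (64 * n + i)).
    by move: Pi; rewrite windowE (nth_map 0%N) ?size_iota ?nth_iota //; lia.
  split=> //; exists (64 * n + i)%N%:Z, (64 * n + i + h)%N%:Z; split; try lia.
  + by exists (64 * n + i)%N => //; split; [lia | apply/hQ => //; lia].
  + by exists (64 * n + i + h)%N => //; split; [lia | apply/hQ => //; lia].
  + move=> z [j [j0 Qj] <-] lt; have := before j.
    have -> : P (fact_class j) by apply/hQ.
    by move=> /(_ ltac:(lia)).
Qed.

Local Close Scope ring_scope.
Local Open Scope classical_set_scope.

Theorem theorem2 :
  gap_sizes fact_sum3sq = [set g : nat | g \in [:: 1; 2; 3; 4]] /\
  gap_sizes fact_not_sum3sq =
    [set g : nat | g \in [:: 1; 2; 3; 4; 5; 6; 7; 8; 9; 10; 11; 12; 13; 14;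
      15; 16; 17; 18; 19; 20; 21; 22; 23; 25; 26; 28; 30; 31; 33; 34; 35;
      37; 38; 42]].
Proof.
have h n : (0 < n)%N -> sum_of_three_squares (n`!)%:Z <-> fact_class n != (false, 7%N).
  by move=> _; apply: three_squares_iff; apply: fact_gt0.
split.
(* In each pair the second entry is a block index: [(4, 38)] says that a gap 4 starts between 2432
   and 2495. In the longer list below the largest index is 2403, within the bound [2 ^ 12]. *)
- apply: (@gap_sizes_fact (fun c => c != (false, 7%N)) _ _
    [:: (1, 1); (2, 1); (3, 1); (4, 38)]%N); [exact: h|..]; by vm_compute.
- apply: (@gap_sizes_fact (fun c => c == (false, 7%N)) _ _
    [:: (1, 1); (2, 2); (3, 2); (4, 3); (5, 1); (6, 1); (7, 1); (8, 2); (9, 2);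
        (10, 1); (11, 5); (12, 2); (13, 1); (14, 12); (15, 37); (16, 2); (17, 10);
        (18, 3); (19, 3); (20, 22); (21, 1); (22, 4); (23, 22); (25, 14); (26, 301);
        (28, 29); (30, 27); (31, 90); (33, 2403); (34, 149); (35, 9); (37, 75);
        (38, 17); (42, 363)]%N); [|by vm_compute..].
  move=> n n0; rewrite h //; split=> [/negP|e]; first by rewrite negbK.
  by apply/negP; rewrite negbK.
Qed.
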